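(* Suppose $\mathcal X$ is $p$-convex and uniformly smooth and $\mathcal Y$ is uniformly smooth. Suppose the operators $F_i$, $i=1,\dots,N$, satisfy conditions (i)-(iii) of the context with solution $x^\dagger$, radius $\nu>0$, set $\mathcal S$ and constants $L_{\max}$, $\gamma\in(0,1)$. Let $x_0\in\mathcal B_\nu(x^\dagger)$, and let the step-sizes $\mu_k>0$ satisfy, for some constant $C>0$, $$1-\gamma-L_{\max}^{p^*}\frac{G_{p^*}}{p^*}\mu_k^{p^*-1}\ge C>0\quad\text{for all }k\in\mathbb N .$$ Let $(x_k)_{k\in\mathbb N}$ be the SGD iterates for exact data defined in the context. If $\sum_{k=1}^\infty\mu_k=\infty$, then $(x_k)$ converges almost surely to a minimizer of $\Psi$, that is, $$\mathbb P\Big(\lim_{k\to\infty}\inf_{\widetilde x\in\mathcal X_{\min}}\|x_k-\widetilde x\|_{\mathcal X}=0\Big)=1 .$$ Moreover, if $\mathcal S$ is closed and convex, $F$ is weak-to-weak continuous, and $\operatorname{null}(F'(x^\dagger))\subset\operatorname{null}(F'(x))$ for all $x\in\mathcal S$, where $x^\dagger$ is the $x_0$-minimum-distance solution, then $(x_k)$ converges almost surely to $x^\dagger$, i.e. $\lim_{k\to\infty}\mathbf B_p(x_k,x^\dagger)=0$ almost surely.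
   Context: Spaces. $\mathcal X,\mathcal Y_1,\dots,\mathcal Y_N$ are real Banach spaces; $\mathcal Y=\mathcal Y_1\times\cdots\times\mathcal Y_N$ carries the norm $\|y\|_{\mathcal Y}=\|(\|y_1\|_{\mathcal Y_1},\dots,\|y_N\|_{\mathcal Y_N})\|_{\ell^r}$ for a fixed $r\ge1$. $p>1$ and $1/p+1/p^*=1$. $\mathcal X$ is $p$-convex if there is $K_p>0$ with $\inf\{1-\tfrac12\|z+w\|:\|z\|=\|w\|=1,\|z-w\|\ge\tau\}\ge K_p\tau^p$ for all $\tau\in(0,2]$. A space is uniformly smooth if $\rho(\tau)/\tau\to0$ as $\tau\searrow0$, where $\rho(\tau)=\sup\{\tfrac12(\|z+\tau w\|+\|z-\tau w\|)-1:\|z\|=\|w\|=1\}$. Duality map. $\mathcal J_p^{\mathcal X}(x)=\{x^*\in\mathcal X^*:\langle x^*,x\rangle=\|x\|\|x^*\|,\ \|x^*\|=\|x\|^{p-1}\}$. For $\mathcal X$ $p$-convex and uniformly smooth it is single-valued and invertible with inverse $\mathcal J_{p^*}^{\mathcal X^*}$. $\jmath_p$ denotes a single-valued selection of the analogous duality map (gauge $t\mapsto t^{p-1}$) on $\mathcal Y_i$. Bregman distance. $\mathbf B_p(z,w)=\frac1{p^*}\|z\|^p+\frac1p\|w\|^p-\langle\mathcal J_p^{\mathcal X}(z),w\rangle$ on $\mathcal X$; analogously $\mathbf B_{p^*}(z^*,w^* )=\frac1p\|z^*\|^{p^*}+\frac1{p^*}\|w^*\|^{p^*}-\langle\mathcal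 J_{p^*}^{\mathcal X^*}(z^* ),w^*\rangle$ on $\mathcal X^*$. $G_{p^*}>0$ is a constant (it exists since $\mathcal X^*$ is $p^*$-smooth) with $\mathbf B_{p^*}(z^*,w^* )\le\frac{G_{p^*}}{p^*}\|w^*-z^*\|^{p^*}$ for all $z^*,w^*\in\mathcal X^*$. $\mathcal B_\nu(x)=\{z\in\mathcal X:\mathbf B_p(z,x)\le\nu\}$. Problem. $F_i:\mathcal D(F_i)\subset\mathcal X\to\mathcal Y_i$, $F=(F_1,\dots,F_N)$, $\mathcal D(F)=\cap_i\mathcal D(F_i)$, exact data $y=(y_1,\dots,y_N)$. $\mathcal X_{\min}=\{x\in\mathcal X:F(x)=y\}$, assumed nonempty. The objective is $\Psi(x)=\frac1N\sum_{i=1}^N\Psi_i(x)$, $\Psi_i(x)=\frac1p\|F_i(x)-y_i\|_{\mathcal Y_i}^p$. Conditions on $F$. $\mathcal S\subset\mathcal D(F)$ is closed and convex, and: (i) there are a solution $x^\dagger$ of $F(x)=y$ and $\nu>0$ with $\mathcal B_\nu(x^\dagger)\subset\mathcal S$; (ii) each $F_i$ is Fréchet differentiable in $\mathcal S$ with $\|F_i'(x)\|\le L_i$ for all $x\in\mathcal S$, and $L_{\max}=\max_iL_i$; (iii) there is $0<\gamma<1$ with $\|F_i(x)-F_i(\tilde x)-F_i'(x)(x-\tilde x)\|_{\mathcal Y_i}\le\gamma\|F_i(x)-F_i(\tilde x)\|_{\mathcal Y_i}$ for all $x,\tilde x\in\mathcal S$ and all $i$. Minimum-distance solution. The $x_0$-minimum-distance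 solution is $x^\dagger\in\mathcal S$ with $F(x^\dagger)=y$ and $\mathbf B_p(x_0,x^\dagger)=\inf\{\mathbf B_p(x_0,x):F(x)=y,\ x\in\mathcal S\}$. SGD. With deterministic $x_0$ and indices $i_1,i_2,\dots$ drawn independently and uniformly from $\{1,\dots,N\}$, $x_{k+1}=\mathcal J_{p^*}^{\mathcal X^*}\big(\mathcal J_p^{\mathcal X}(x_k)-\mu_{k+1}F_{i_{k+1}}'(x_k)^*\jmath_p(F_{i_{k+1}}(x_k)-y_{i_{k+1}})\big)$, $k=0,1,\dots$. *)

(* Defs.v *)
From HB Require Import structures.
From mathcomp Require Import all_boot all_order all_algebra finmap.
From mathcomp Require Import ring.
From mathcomp Require Import all_classical all_reals all_analysis.

Set Implicit Arguments.
Unset Strict Implicit.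
Unset Printing Implicit Defensive.

Import Order.TTheory GRing.Theory Num.Theory.
Import numFieldNormedType.Exports.

Local Open Scope classical_set_scope.
Local Open Scope ring_scope.

Section BoundedLinearPred.
Context {R : realType} {V W : normedModType R}.

Definition bounded_linear (f : V -> W) : Prop :=
  linear f /\ exists M : R, forall x, `|f x| <= M * `|x|.

Definition blin_pred : {pred V -> W} := mem [set f | bounded_linear f].

Lemma blin_predP (f : V -> W) : reflect (bounded_linear f) (f \in blin_pred).
Proof. by apply: (iffP idP); rewrite !inE. Qed.

Lemma blin_submod : submod_closed blin_pred.
Proof.
split.
  apply/blin_predP; split; first by move=> a x y; rewrite scaler0 addr0.
  by exists 0 => x; rewrite normr0 mul0r.
move=> a f g /blin_predP[lf [M fM]] /blin_predP[lg [K gK]].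
apply/blin_predP; split.
  move=> b x y; change (a *: f (b *: x + y) + g (b *: x + y) =
    b *: (a *: f x + g x) + (a *: f y + g y)).
  by rewrite lf lg !scalerDr !scalerA (mulrC a b) addrACA.
exists (`|a| * M + K) => x; change (`|a *: f x + g x| <= (`|a| * M + K) * `|x|).
rewrite (le_trans (ler_normD _ _))// mulrDl lerD// normrZ -mulrA.
by rewrite ler_wpM2l.
Qed.

HB.instance Definition _ := GRing.isSubmodClosed.Build R (V -> W) blin_pred
  blin_submod.

End BoundedLinearPred.

Record blin (R : realType) (V W : normedModType R) :=
  BLin { blin_fun :> V -> W ; _ : blin_fun \in blin_pred }.

Section BoundedLinear.
Context (R : realType) (V W : normedModType R).

HB.instance Definition _ := [isSub for @blin_fun R V W].
HB.instance Definition _ := gen_eqMixin (blin V W).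
HB.instance Definition _ := gen_choiceMixin (blin V W).
HB.instance Definition _ := [SubChoice_isSubLmodule of blin V W by <:].

Lemma blinP (f : blin V W) : bounded_linear f.
Proof. by case: f => f fP; exact/blin_predP. Qed.

Lemma blinD (f g : blin V W) x : (f + g) x = f x + g x.
Proof. by []. Qed.

Lemma blinZ a (f : blin V W) x : (a *: f) x = a *: f x.
Proof. by []. Qed.

Lemma blin_ext (f g : blin V W) : (forall x, f x = g x) -> f = g.
Proof. by move=> fg; apply: val_inj; apply/funext. Qed.

Definition opnorm (f : blin V W) : R :=
  sup [set `|f x| | x in [set x | `|x| <= 1]].

Let img (f : blin V W) := [set `|f x| | x in [set x : V | `|x| <= 1]].

Let img0 (f : blin V W) : img f !=set0.
Proof. by exists `|f 0|, 0 => //=; rewrite normr0. Qed.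

Let img_ub (f : blin V W) : has_ubound (img f).
Proof.
have [_ [M fM]] := blinP f; exists `|M| => _ [x /= x1 <-].
rewrite (le_trans (fM x))// (@le_trans _ _ (`|M| * `|x|)) ?ler_wpM2r ?ler_norm//.
by rewrite -[leRHS]mulr1 ler_wpM2l.
Qed.

Lemma opnorm_ge (f : blin V W) x : `|f x| <= opnorm f * `|x|.
Proof.
have [lf _] := blinP f.
have fZ a z : f (a *: z) = a *: f z.
  have f0 : f 0 = 0 by have := lf (-1) 0 0; rewrite scaler0 addr0 scaleN1r addNr.
  by have := lf a z 0; rewrite f0 !addr0.
have [->|x0] := eqVneq x 0.
  by rewrite -(scale0r (0 : V)) fZ !scale0r !normr0 mulr0.
have nx : 0 < `|x| by rewrite normr_gt0.
rewrite -ler_pdivrMr//; apply: ub_le_sup; first exact: img_ub.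
exists (`|x|^-1 *: x) => /=.
  by rewrite normrZ ger0_norm ?invr_ge0// mulVf// gt_eqF.
by rewrite fZ normrZ ger0_norm ?invr_ge0// mulrC.
Qed.

Lemma opnormD (f g : blin V W) : opnorm (f + g) <= opnorm f + opnorm g.
Proof.
apply: ge_sup; first exact: (@img0 (f + g)).
move=> _ [x x1 <-]; rewrite blinD (le_trans (ler_normD _ _))// lerD//.
  by apply: ub_le_sup; [exact: (@img_ub f)|exists x].
by apply: ub_le_sup; [exact: (@img_ub g)|exists x].
Qed.

Lemma opnorm_le_scale a (f : blin V W) : opnorm (a *: f) <= `|a| * opnorm f.
Proof.
apply: ge_sup; first exact: (@img0 (a *: f)).
move=> _ [x x1 <-]; rewrite blinZ normrZ ler_wpM2l//.
by apply: ub_le_sup; [exact: (@img_ub f)|exists x].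
Qed.

Lemma opnormZ a (f : blin V W) : opnorm (a *: f) = `|a| * opnorm f.
Proof.
apply/eqP; rewrite eq_le opnorm_le_scale/=.
have [->|a0] := eqVneq a 0.
  rewrite normr0 mul0r; apply: ub_le_sup; first exact: img_ub.
  exists 0; first by rewrite /= normr0.
  by rewrite blinZ scale0r normr0.
rewrite -ler_pdivlMl ?normr_gt0//.
have := opnorm_le_scale a^-1 (a *: f).
by rewrite scalerA mulVf// scale1r normfV.
Qed.

Lemma opnorm_eq0 (f : blin V W) : opnorm f = 0 -> f = 0.
Proof.
move=> f0; apply: blin_ext => x; apply/eqP; rewrite -normr_le0.
by have := opnorm_ge f x; rewrite f0 mul0r.
Qed.

HB.instance Definition _ :=
  Lmodule_isNormed.Build R (blin V W) opnormD opnormZ opnorm_eq0.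

Lemma blin_normE (f : blin V W) : `|f| = opnorm f. Proof. by []. Qed.

End BoundedLinear.

Section Duality.
Context {R : realType}.
Local Notation dual V := (blin V R^o).

Lemma adjoint_subproof (V W : normedModType R) (A : blin V W)
  (f : dual W) : (f \o A) \in @blin_pred R V R^o.
Proof.
have [lA _] := blinP A; have [lf _] := blinP f.
apply/blin_predP; split; first by move=> a x y /=; rewrite lA lf.
exists (opnorm f * opnorm A) => x /=; rewrite (le_trans (opnorm_ge f _))//.
have f0 : 0 <= opnorm f by exact: (normr_ge0 f).
by rewrite -mulrA ler_wpM2l// opnorm_ge.
Qed.

Definition adjoint (V W : normedModType R) (A : blin V W) (f : dual W) :
  dual V := BLin (adjoint_subproof A f).

Lemma to_bidual_subproof (V : normedModType R) (x : V) :
  (fun f : dual V => f x) \in @blin_pred R (dual V) R^o.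
Proof.
apply/blin_predP; split; first by [].
by exists `|x| => f; rewrite mulrC; exact: opnorm_ge.
Qed.

Definition to_bidual (V : normedModType R) (x : V) :
  dual (dual V) := BLin (to_bidual_subproof x).

(* The identification of the bidual with the space; meaningful on a reflexive
   space, with junk value 0 outside the range of the canonical embedding. *)
Definition of_bidual (V : normedModType R) (L : dual (dual V)) : V :=
  xget 0 [set x | to_bidual x = L].

Definition duality_set (V : normedModType R) (p : R) (x : V) :
  set (dual V) :=
  [set f : dual V | f x = `|x| * `|f| /\ `|f| = `|x| `^ (p - 1)].

(* The single-valued duality map: the element of [duality_set p x] when there is
   exactly one, as is the case on a smooth space. *)
Definition duality_map (V : normedModType R) (p : R) (x : V) : dual V :=
  xget 0 (duality_set p x).

(* [ps] is the conjugate exponent of [p]; exchanging the two and taking a dual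
   space for [V] gives the Bregman distance on the dual, whose duality map takes
   values in the bidual. *)
Definition bregman (V : normedModType R) (p ps : R) (z w : V) : R :=
  ps^-1 * `|z| `^ p + p^-1 * `|w| `^ p - duality_map p z w.

Definition bregman_ball (V : normedModType R) (p ps : R) (x : V) (nu : R) :
  set V := [set z | bregman p ps z x <= nu].

End Duality.

Section Geometry.
Context {R : realType}.

(* The infimum is taken in the extended reals so that it is +oo when there are
   no admissible [z] and [w] (the trivial space). *)
Definition p_convex (V : normedModType R) (p : R) : Prop :=
  exists2 K : R, 0 < K & forall t : R, 0 < t <= 2 ->
    ((K * t `^ p)%R%:E <=
     ereal_inf [set (1 - 2^-1 * `|zw.1 + zw.2|)%R%:E | zw in
       [set zw : V * V |
         [/\ `|zw.1| = 1, `|zw.2| = 1 & t <= `|zw.1 - zw.2| ]%R]])%E.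

Definition smoothness_modulus (V : normedModType R) (t : R) : R :=
  sup [set 2^-1 * (`|zw.1 + t *: zw.2| + `|zw.1 - t *: zw.2|) - 1 | zw in
    [set zw : V * V | `|zw.1| = 1 /\ `|zw.2| = 1]].

Definition uniformly_smooth (V : normedModType R) : Prop :=
  smoothness_modulus V t / t @[t --> 0^'+] --> (0 : R).

End Geometry.

Lemma minkowski_sum (R : realType) (r : R) (N : nat) (u v : 'I_N -> R)
  (a b : R) : 1 <= r -> 0 < a -> 0 < b ->
  (forall i, 0 <= u i) -> (forall i, 0 <= v i) ->
  \sum_(i < N) (u i / a) `^ r = 1 -> \sum_(i < N) (v i / b) `^ r = 1 ->
  \sum_(i < N) (u i + v i) `^ r <= (a + b) `^ r.
Proof.
move=> r1 a0 b0 u0 v0 ua vb; have s0 : 0 < a + b by rewrite addr_gt0.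
have r0 : 0 < r by exact: lt_le_trans r1.
have [an0 bn0 sn0] : [/\ a != 0, b != 0 & a + b != 0] by rewrite !gt_eqF.
have w0 : 0 <= a / (a + b) by rewrite divr_ge0 ?(ltW a0) ?(ltW s0).
have w1 : a / (a + b) <= 1 by rewrite ler_pdivrMr// mul1r lerDl ltW.
have wC : 1 - a / (a + b) = b / (a + b) by field.
have cvx (s t : R) : 0 <= s -> 0 <= t ->
    (a / (a + b) * s + b / (a + b) * t) `^ r <=
    a / (a + b) * s `^ r + b / (a + b) * t `^ r.
  move=> s_ge0 t_ge0; rewrite -wC.
  by apply: (convex_powR r1 (Itv01 w0 w1));
    rewrite ?inE/= ?in_itv/= ?s_ge0 ?t_ge0.
apply: (@le_trans _ _ (\sum_(i < N) (a + b) `^ r *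
    (a / (a + b) * (u i / a) `^ r + b / (a + b) * (v i / b) `^ r))).
  apply: ler_sum => i _.
  have -> : u i + v i =
      (a + b) * (a / (a + b) * (u i / a) + b / (a + b) * (v i / b)).
    by field; rewrite an0 bn0 sn0.
  have ua0 : 0 <= u i / a by rewrite divr_ge0 ?(ltW a0).
  have vb0 : 0 <= v i / b by rewrite divr_ge0 ?(ltW b0).
  have wb0 : 0 <= b / (a + b) by rewrite divr_ge0 ?(ltW b0) ?(ltW s0).
  have c0 : 0 <= a / (a + b) * (u i / a) + b / (a + b) * (v i / b).
    by apply: addr_ge0; exact: mulr_ge0.
  rewrite powRM ?(ltW s0)//.
  by apply: ler_wpM2l; [exact: powR_ge0|exact: cvx].
have -> : \sum_(i < N) (a + b) `^ r * (a / (a + b) * (u i / a) `^ r +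
    b / (a + b) * (v i / b) `^ r) = (a + b) `^ r * (a / (a + b) *
    (\sum_(i < N) (u i / a) `^ r) + b / (a + b) * (\sum_(i < N) (v i / b) `^ r)).
  by rewrite !mulr_sumr -big_split/= mulr_sumr.
by rewrite ua vb !mulr1 -mulrDl mulfV ?mulr1.
Qed.

Definition lrprod (R : realType) (r : R) (r1 : 1 <= r) (N : nat)
  (Y : 'I_N -> normedModType R) : Type := forall i, Y i.

Section LrProduct.
Context (R : realType) (r : R) (r1 : 1 <= r) (N : nat).
Context (Y : 'I_N -> normedModType R).
Local Notation T := (lrprod r1 Y).

HB.instance Definition _ := gen_eqMixin T.
HB.instance Definition _ := gen_choiceMixin T.

Let add (f g : T) : T := fun i => f i + g i.
Let opp (f : T) : T := fun i => - f i.
Let scale (a : R) (f : T) : T := fun i => a *: f i.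
Let zero : T := fun i => 0.

Let addA : associative add.
Proof. by move=> f g h; apply/functional_extensionality_dep => i; exact: addrA. Qed.
Let addC : commutative add.
Proof. by move=> f g; apply/functional_extensionality_dep => i; exact: addrC. Qed.
Let add0 : left_id zero add.
Proof. by move=> f; apply/functional_extensionality_dep => i; exact: add0r. Qed.
Let addN : left_inverse zero opp add.
Proof. by move=> f; apply/functional_extensionality_dep => i; exact: addNr. Qed.

HB.instance Definition _ := GRing.isZmodule.Build T addA addC add0 addN.

Let scaleA a b (v : T) : scale a (scale b v) = scale (a * b) v.
Proof. by apply/functional_extensionality_dep => i; exact: scalerA. Qed.
Let scale1 : left_id 1 scale.
Proof. by move=> v; apply/functional_extensionality_dep => i; exact: scale1r. Qed.
Let scaleDr : right_distributive scale +%R.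
Proof. by move=> a u v; apply/functional_extensionality_dep => i; exact: scalerDr. Qed.
Let scaleDl (v : T) : {morph scale^~ v : a b / a + b}.
Proof. by move=> a b; apply/functional_extensionality_dep => i; exact: scalerDl. Qed.

HB.instance Definition _ :=
  GRing.Zmodule_isLmodule.Build R T scaleA scale1 scaleDr scaleDl.

Definition lrnorm (y : T) : R := (\sum_(i < N) `|y i| `^ r) `^ r^-1.

Let r0 : 0 < r. Proof. exact: lt_le_trans r1. Qed.
Let rn0 : r != 0. Proof. by rewrite gt_eqF. Qed.

Let sum_ge0 (y : T) : 0 <= \sum_(i < N) `|y i| `^ r.
Proof. by apply: sumr_ge0 => i _; exact: powR_ge0. Qed.

Let lrnormX (y : T) : lrnorm y `^ r = \sum_(i < N) `|y i| `^ r.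
Proof. by rewrite /lrnorm -powRrM mulVf// powRr1. Qed.

Let lrnorm_eq0 (y : T) : lrnorm y = 0 -> y = 0.
Proof.
move=> y0; have := lrnormX y; rewrite y0 powR0// => /esym/eqP.
rewrite psumr_eq0 => [/allP h|i _]; last exact: powR_ge0.
apply/functional_extensionality_dep => i.
have /= := h i (mem_index_enum _).
by rewrite powR_eq0 rn0 andbT normr_eq0 => /eqP.
Qed.

Let lrnormZ a (y : T) : lrnorm (a *: y) = `|a| * lrnorm y.
Proof.
rewrite /lrnorm (_ : \sum_(i < N) _ = `|a| `^ r * \sum_(i < N) `|y i| `^ r).
  by rewrite powRM ?powR_ge0// -powRrM mulfV// powRr1.
rewrite mulr_sumr; apply: eq_bigr => i _.
by rewrite -powRM// -normrZ.
Qed.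

Let lrnorm_sumV (z : T) : 0 < lrnorm z ->
  \sum_(i < N) (`|z i| / lrnorm z) `^ r = 1.
Proof.
move=> z0; under eq_bigr do rewrite powRM ?invr_ge0 ?(ltW z0)//.
rewrite -mulr_suml -lrnormX -powRM ?invr_ge0 ?(ltW z0)//.
by rewrite mulfV ?gt_eqF// powR1.
Qed.

Let lrnormD (x y : T) : lrnorm (x + y) <= lrnorm x + lrnorm y.
Proof.
have nge0 (z : T) : 0 <= lrnorm z by exact: powR_ge0.
have [x0|xn0] := eqVneq (lrnorm x) 0.
  by rewrite x0 (lrnorm_eq0 x0) !add0r.
have [y0|yn0] := eqVneq (lrnorm y) 0.
  by rewrite y0 (lrnorm_eq0 y0) !addr0.
have a0 : 0 < lrnorm x by rewrite lt_def xn0 nge0.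
have b0 : 0 < lrnorm y by rewrite lt_def yn0 nge0.
have sN := minkowski_sum r1 a0 b0 (fun i => normr_ge0 (x i))
  (fun i => normr_ge0 (y i)) (lrnorm_sumV a0) (lrnorm_sumV b0).
have sD : \sum_(i < N) `|(x + y) i| `^ r <= \sum_(i < N) (`|x i| + `|y i|) `^ r.
  apply: ler_sum => i _.
  by rewrite ge0_ler_powR ?(ltW r0) ?nnegrE ?addr_ge0//; exact: ler_normD.
have s0 := addr_ge0 (nge0 x) (nge0 y).
move: (lrnorm x + lrnorm y) s0 (le_trans sD sN) => c c0 sc.
have -> : c = (c `^ r) `^ r^-1 by rewrite -powRrM mulfV// powRr1.
by rewrite /lrnorm ge0_ler_powR ?nnegrE ?invr_ge0 ?powR_ge0 ?(ltW r0) ?sum_ge0.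
Qed.

HB.instance Definition _ :=
  Lmodule_isNormed.Build R T lrnormD lrnormZ lrnorm_eq0.

Lemma lrprod_normE (y : T) : `|y| = (\sum_(i < N) `|y i| `^ r) `^ r^-1.
Proof. by []. Qed.

End LrProduct.

(* The initial topology for the evaluations at all bounded functionals. *)
Definition weak_topology (R : realType) (V : normedModType R) : topologicalType :=
  initial_topology
    (fun x : V => (fun f => f x) : prod_topology (fun _ : blin V R^o => R^o)).

(* Continuity of [f], defined on [D], for the weak topologies on both sides. *)
Definition weak_to_weak_continuous (R : realType) (V W : normedModType R)
    (D : set V) (f : V -> W) : Prop :=
  {within (D : set (weak_topology V)),
    continuous (f : weak_topology V -> weak_topology W)}.

(* The values of [f] outside [D] play no role; when [D] is a neighbourhood of [x]
   this is the usual Frechet derivative at [x]. *)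
Definition is_frechet_derivative (R : realType) (V W : normedModType R)
    (D : set V) (f : V -> W) (x : V) (A : blin V W) : Prop :=
  let near_x := within D (nbhs x) in
  (fun z => f z - f x - A (z - x)) =o_near_x (fun z => z - x).

Definition iid_uniform (d : measure_display) (T : measurableType d)
    (R : realType) (P : probability T R) (N : nat) (idx : nat -> T -> 'I_N) :
    Prop :=
  [/\ forall k i, measurable (idx k @^-1` [set i]),
      forall k i, P (idx k @^-1` [set i]) = (N%:R^-1)%:E
    & forall (K : {fset nat}) (A : nat -> set 'I_N),
        P (\bigcap_(k in [set` K]) idx k @^-1` A k) =
        (\prod_(k <- K) P (idx k @^-1` A k))%E].

Section Problem.
Context (R : realType) (X : normedModType R).
Context (N : nat) (Y : 'I_N -> normedModType R).

(* [F i] is a total function of which only the restriction to [D i] matters. *)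
Definition solutions (D : 'I_N -> set X) (F : forall i, X -> Y i)
    (y : forall i, Y i) : set X :=
  [set x | forall i, D i x /\ F i x = y i].

Definition min_distance_solution (p ps : R) (D : 'I_N -> set X)
    (F : forall i, X -> Y i) (y : forall i, Y i) (S : set X) (x0 xd : X) : Prop :=
  [/\ S xd, solutions D F y xd &
      bregman p ps x0 xd =
      inf [set bregman p ps x0 x | x in solutions D F y `&` S]].

(* [mu k] and [idx k] are the step size and the index used to pass from the
   [k]-th to the [k.+1]-st iterate, usually numbered [k.+1]; [of_bidual] makes
   the dual duality map, with values in the bidual, take values in [X]. *)
Fixpoint sgd (p ps : R) (F : forall i, X -> Y i)
    (dF : forall i, X -> blin X (Y i)) (j : forall i, Y i -> blin (Y i) R^o)
    (y : forall i, Y i) (mu : nat -> R) (x0 : X) (idx : nat -> 'I_N) (k : nat) :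
    X :=
  if k is k'.+1 then
    let x := sgd p ps F dF j y mu x0 idx k' in
    let i := idx k' in
    of_bidual (duality_map ps
      (duality_map p x - mu k' *: adjoint (dF i x) (j i (F i x - y i))))
  else x0.

End Problem.

(* Main.v *)
Require Import Defs.
From HB Require Import structures.
From mathcomp Require Import all_boot all_order all_algebra finmap.
From mathcomp Require Import ring lra.
From mathcomp Require Import all_classical all_reals all_analysis.
From mathcomp Require Import measurable_realfun.

Set Implicit Arguments.
Unset Strict Implicit.
Unset Printing Implicit Defensive.

Import Order.TTheory GRing.Theory Num.Theory.
Import numFieldNormedType.Exports.

Local Open Scope classical_set_scope.
Local Open Scope ring_scope.

(** The proof separates a pathwise argument from one use of expectation.

   Duality.  Uniform smoothness makes the norm of [X] differentiable, so the duality
   map [J] exists and is single-valued ([norming_functional], [duality_mapP]).  By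
   convexity every functional attains its norm ([norm_attained]), so [J] is onto;
   smoothness of the dual makes the dual duality map single-valued, and the two
   maps are inverse to each other ([duality_mapVK]).  The iteration therefore reads
   [J (x k.+1) = J (x k) - g k], with [g k] a multiple of the gradient of the
   sampled term.

   Descent.  The smoothness inequality of the dual, conjugated, bounds the Bregman
   distance from below by the [p]-th power of the norm distance ([bregman_ge]).
   Used directly, with the cone condition and the step size bound, it shows that
   for every choice of indices each step decreases the distance to any solution in
   [S] by at least [C * mu k] times the [p]-th power of the sampled residual
   ([sgd_descent]).  So the iterates never leave the ball, and the weighted sum of
   the sampled residuals has a bound that does not depend on the path
   ([sgd_sum_residuals]).

   Expectation.  The index drawn at time [k] is uniform and independent of [x k],
   so the same weighted sum with the sampled residual replaced by the full one has
   finite expectation, hence is finite almost surely ([ae_bounded_averages]).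

   Convergence.  On a path with finite sum of full residuals, divergence of the
   step sizes makes the residual small infinitely often.  Along the indices where
   it attains its running minimum, the three-point identity and the cone condition
   bound the Bregman distance between two iterates by tails of convergent series
   ([dual_increment]); the limit of this Cauchy sequence is a solution, and by
   monotonicity the whole path converges to it ([sgd_path_cvg]).

   Identification of the limit.  Under the null space condition every dual step
   annihilates [xh - xmd], where [xh] is the limit and [xmd] the minimum-distance
   solution.  Hence [B (x n) xmd - B (x n) xh] does not depend on [n]; it is
   nonpositive at [n = 0], and [B (x n) xh] tends to zero, so [B (x n) xmd] does
   too ([sgd_min_distance_cvg]).

   Both events are measurable, since each iterate depends on finitely many
   indices ([measurable_cvg0]). *)

(** * Norming functionals of smooth norms *)

Section BoundedLinearTheory.
Context (R : realType) (V W : normedModType R).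
Implicit Types f g : blin V W.

Lemma blin_addE f x y : f (x + y) = f x + f y.
Proof. by have [lf _] := blinP f; have := lf 1 x y; rewrite !scale1r. Qed.

Lemma blin_eval0 f : f 0 = 0.
Proof. by apply: (@addrI _ (f 0)); rewrite -blin_addE !addr0. Qed.

Lemma blin_scaleE f a x : f (a *: x) = a *: f x.
Proof.
by have [lf _] := blinP f; have := lf a x 0; rewrite blin_eval0 !addr0.
Qed.

Lemma blin_oppE f x : f (- x) = - f x.
Proof. by rewrite -scaleN1r blin_scaleE scaleN1r. Qed.

Lemma blin_subE f x y : f (x - y) = f x - f y.
Proof. by rewrite blin_addE blin_oppE. Qed.

Lemma blin_normP f x : `|f x| <= `|f| * `|x|.
Proof. exact: opnorm_ge. Qed.

Lemma blin_norm_le f M : 0 <= M -> (forall x, `|f x| <= M * `|x|) -> `|f| <= M.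
Proof.
move=> M0 fM; rewrite blin_normE; apply: ge_sup.
  by exists `|f 0|, 0 => //=; rewrite normr0.
move=> _ [x /= x1 <-]; rewrite (le_trans (fM x))// -[leRHS]mulr1.
exact: ler_wpM2l.
Qed.

End BoundedLinearTheory.

Section DualTheory.
Context (R : realType) (V : normedModType R).
Local Notation dual V := (blin V R^o).
Implicit Types f g : dual V.

Lemma dual_le f x : f x <= `|f| * `|x|.
Proof. by rewrite (le_trans (ler_norm _))// blin_normP. Qed.

Lemma to_bidualE (x : V) f : to_bidual x f = f x.
Proof. by []. Qed.

Lemma dual_addE f g x : (f + g) x = f x + g x.
Proof. by []. Qed.

Lemma dual_subE f g x : (f - g) x = f x - g x.
Proof. by []. Qed.

Lemma dual_scaleE (a : R) f x : (a *: f) x = a * f x.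
Proof. by []. Qed.

Lemma dual_evalZ f a x : f (a *: x) = a * f x.
Proof. exact: blin_scaleE. Qed.

End DualTheory.

Section Norming.
Context (R : realType) (V : normedModType R).
Variable (u : V).
Hypothesis u1 : `|u| = 1.

(** The one-sided derivative of the norm at [u] in the direction [h]: by
   convexity the difference quotients decrease with the step, so that their limit
   at zero is an infimum. *)
Definition norm_slope (h : V) : R :=
  inf [set (`|u + t *: h| - 1) / t | t in [set t : R | 0 < t]].

Let slopes h := [set (`|u + t *: h| - 1) / t | t in [set t : R | 0 < t]].

Let slopes0 h : slopes h !=set0.
Proof. by exists ((`|u + 1 *: h| - 1) / 1), 1 => //=. Qed.

Let slope_lb h (t : R) : 0 < t -> - `|h| <= (`|u + t *: h| - 1) / t.
Proof.
move=> t0; rewrite ler_pdivlMr// mulNr lerBrDl -[X in X - _]u1 lerBlDr.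
have -> : `|h| * t = `|t *: h| by rewrite normrZ gtr0_norm// mulrC.
by rewrite -{1}(addrK (t *: h) u) (le_trans (ler_normB _ _)).
Qed.

Let slopes_lb h : has_lbound (slopes h).
Proof. by exists (- `|h|) => _ [t /= t0 <-]; exact: slope_lb. Qed.

Lemma norm_slope_le h (t : R) : 0 < t -> norm_slope h <= (`|u + t *: h| - 1) / t.
Proof. by move=> t0; apply: ge_inf; [exact: slopes_lb|exists t]. Qed.

Lemma le_norm_slope h c :
  (forall t : R, 0 < t -> c <= (`|u + t *: h| - 1) / t) -> c <= norm_slope h.
Proof.
by move=> hc; apply: lb_le_inf; [exact: slopes0|move=> _ [t /= t0 <-]; exact: hc].
Qed.

Lemma norm_slope_le_norm h : norm_slope h <= `|h|.
Proof.
apply: (le_trans (norm_slope_le h ltr01)); rewrite divr1 scale1r lerBlDl -u1.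
exact: ler_normD.
Qed.

Lemma norm_slope_self : norm_slope u = 1.
Proof.
have E t : 0 < t -> (`|u + t *: u| - 1) / t = 1.
  move=> t0; rewrite -{1}(scale1r u) -scalerDl normrZ u1 mulr1 ger0_norm; last lra.
  by rewrite addrC addKr divff// gt_eqF.
apply/eqP; rewrite eq_le; apply/andP; split.
  by rewrite -[leRHS](E 1)// norm_slope_le.
by apply: le_norm_slope => t t0; rewrite E.
Qed.

Lemma norm_slope_subadd a b : norm_slope (a + b) <= norm_slope a + norm_slope b.
Proof.
rewrite -lerBlDr; apply: le_norm_slope => s s0.
rewrite lerBlDr -lerBlDl; apply: le_norm_slope => t t0.
rewrite lerBlDl.
have st0 : 0 < s + t by rewrite addr_gt0.
have stn : s + t != 0 by rewrite gt_eqF.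
have [sn tn] : s != 0 /\ t != 0 by rewrite !gt_eqF.
have w0 : 0 < s * t / (s + t) by rewrite divr_gt0 ?mulr_gt0.
apply: (le_trans (norm_slope_le _ w0)); rewrite ler_pdivrMr//.
(* the harmonic step makes the new point a convex combination of the two *)
have -> : u + (s * t / (s + t)) *: (a + b) =
    (t / (s + t)) *: (u + s *: a) + (s / (s + t)) *: (u + t *: b).
  have E : t / (s + t) + s / (s + t) = 1 by field.
  rewrite !scalerDr !scalerA addrACA -scalerDl E scale1r; congr (_ + (_ + _)).
    by congr (_ *: _); field.
  by congr (_ *: _); field.
have := ler_normD ((t / (s + t)) *: (u + s *: a)) ((s / (s + t)) *: (u + t *: b)).
have [t1 s1] : 0 <= t / (s + t) /\ 0 <= s / (s + t) by rewrite !divr_ge0 ?ltW.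
rewrite (normrZ (t / (s + t))) (normrZ (s / (s + t))) (ger0_norm t1) (ger0_norm s1).
move=> H; rewrite lerBlDr (le_trans H)//.
set A := `|u + s *: a|; set B := `|u + t *: b|.
suff -> : ((A - 1) / s + (B - 1) / t) * (s * t / (s + t)) + 1 =
   t / (s + t) * A + s / (s + t) * B by [].
by field; rewrite ?sn ?tn ?stn.
Qed.

Lemma norm_slopeZ c h : 0 < c -> norm_slope (c *: h) = c * norm_slope h.
Proof.
move=> c0; have cn : c != 0 by rewrite gt_eqF.
apply/eqP; rewrite eq_le; apply/andP; split.
  rewrite -ler_pdivrMl//; apply: le_norm_slope => t t0.
  have tn : t != 0 by rewrite gt_eqF.
  rewrite ler_pdivrMl//; apply: (le_trans (norm_slope_le _ (divr_gt0 t0 c0))).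
  rewrite scalerA divfK// invfM invrK mulrA le_eqVlt; apply/orP; left; apply/eqP.
  by field.
apply: le_norm_slope => t t0.
have tn : t != 0 by rewrite gt_eqF.
have := norm_slope_le h (mulr_gt0 t0 c0); rewrite scalerA => H.
rewrite -ler_pdivlMl// (le_trans H)// le_eqVlt; apply/orP; left; apply/eqP.
by field; rewrite tn cn.
Qed.

End Norming.

Section SmoothNorm.
Context (R : realType) (V : normedModType R).
Local Notation dual V := (blin V R^o).
Hypothesis V_smooth : uniformly_smooth V.

Lemma smoothness_modulus_ge (u h : V) (t : R) : 0 < t -> `|u| = 1 -> `|h| = 1 ->
  2^-1 * (`|u + t *: h| + `|u - t *: h|) - 1 <= smoothness_modulus V t.
Proof.
move=> t0 u1 h1; apply: ub_le_sup; last by exists (u, h).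
exists t => _ [[z w] /= [z1 w1] <-].
have n s : `|s *: w| = `|s| by rewrite normrZ w1 mulr1.
have := ler_normD z (t *: w); have := ler_normB z (t *: w).
rewrite !n z1 gtr0_norm//; lra.
Qed.

(** The sum of the two slopes is bounded by the second difference quotient of the
   norm, which is what the modulus of smoothness controls. *)
Lemma norm_slope_opp (u h : V) : `|u| = 1 ->
  norm_slope u h + norm_slope u (- h) <= 0.
Proof.
move=> u1.
have unit_case k : `|k| = 1 -> norm_slope u k + norm_slope u (- k) <= 0.
  move=> k1; apply/ler_addgt0Pr => e e0; rewrite add0r.
  have e20 : 0 < e / 2 by rewrite divr_gt0.
  have /cvgrPdist_lt/(_ _ e20) He := V_smooth.
  have [t [t0 tH]] : exists t : R, 0 < t /\ `|0 - smoothness_modulus V t / t| < e / 2.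
    near (0:R)^'+ => t; exists t; split; first by near: t; exact: nbhs_right_gt.
    by near: t.
  have := norm_slope_le u1 k t0; have := norm_slope_le u1 (- k) t0.
  rewrite scalerN => H1 H2.
  have := smoothness_modulus_ge t0 u1 k1.
  move: tH; rewrite sub0r normrN => /(le_lt_trans (ler_norm _)).
  rewrite ltr_pdivrMr// => tH H3.
  have : (`|u + t *: k| - 1) / t + (`|u - t *: k| - 1) / t <= e.
    rewrite -mulrDl ler_pdivrMr//; lra.
  lra.
have [->|h0] := eqVneq h 0.
  rewrite oppr0; have := norm_slope_le_norm u1 0; rewrite normr0; lra.
have nh : 0 < `|h| by rewrite normr_gt0.
have := unit_case (`|h|^-1 *: h); rewrite normrZ normfV normr_id mulVf ?gt_eqF//.
have n0 : 0 < `|h|^-1 by rewrite invr_gt0.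
by rewrite -scalerN !(norm_slopeZ u1 _ n0) -mulrDr pmulr_rle0//; exact.
Unshelve. all: by end_near. Qed.

Lemma norm_slopeN (u h : V) : `|u| = 1 -> norm_slope u (- h) = - norm_slope u h.
Proof.
move=> u1; have H := norm_slope_opp h u1.
have := norm_slope_subadd u1 h (- h); rewrite subrr.
have : norm_slope u 0 = 0.
  have := norm_slopeZ u1 0 (ltr0n _ 2); rewrite scaler0; lra.
move=> ->; lra.
Qed.

(** The slope is sublinear for any norm; being odd as well, it is linear. *)
Lemma norm_slope_blin (u : V) : `|u| = 1 ->
  (norm_slope u : V -> R^o) \in @blin_pred R V R^o.
Proof.
move=> u1.
have addE a b : norm_slope u (a + b) = norm_slope u a + norm_slope u b.
  apply/eqP; rewrite eq_le norm_slope_subadd//=.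
  have := norm_slope_subadd u1 (- a) (- b).
  rewrite -opprD !norm_slopeN//; lra.
have zeroE : norm_slope u 0 = 0 by have := addE 0 0; rewrite addr0; lra.
have scaleE c h : norm_slope u (c *: h) = c * norm_slope u h.
  have [c0|c0|->] := ltrgtP c 0; last by rewrite scale0r mul0r.
  - rewrite -[in LHS](opprK c) scaleNr norm_slopeN//.
    by rewrite norm_slopeZ ?oppr_gt0// mulNr opprK.
  - exact: norm_slopeZ.
apply/blin_predP; split; first by move=> a x y; rewrite addE scaleE.
exists 1 => x; rewrite mul1r ler_norml norm_slope_le_norm// andbT.
by rewrite lerNl -norm_slopeN// -(normrN x) norm_slope_le_norm.
Qed.

(** Any norming functional at [u] lies below the slope in every direction and its
   opposite, so it is the slope.  Smoothness thus gives existence and uniqueness at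
   once. *)
Lemma norming_functional (u : V) : `|u| = 1 ->
  exists f : dual V, [/\ f u = 1, `|f| <= 1 &
    forall g : dual V, g u = 1 -> `|g| <= 1 -> g = f].
Proof.
move=> u1; exists (BLin (norm_slope_blin u1)); split.
- exact: norm_slope_self.
- apply: blin_norm_le => // x /=; rewrite mul1r ler_norml norm_slope_le_norm//.
  by rewrite andbT lerNl -norm_slopeN// -(normrN x) norm_slope_le_norm.
- move=> g gu g1; apply: blin_ext => /= h.
  have le k : g k <= norm_slope u k.
    apply: le_norm_slope => t t0; rewrite ler_pdivlMr// lerBrDl -[X in X + _]gu.
    rewrite mulrC -dual_evalZ -blin_addE (le_trans (dual_le _ _))//.
    by rewrite -[leRHS]mul1r ler_wpM2r.
  apply/eqP; rewrite eq_le le/=.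
  by have := le (- h); rewrite norm_slopeN// blin_oppE lerN2.
Qed.

End SmoothNorm.

(** * Duality maps and norm attainment *)

Section ConjugateExponents.
Context (R : realType) (p ps : R).
Hypotheses (p1 : 1 < p) (pps : p^-1 + ps^-1 = 1).

Lemma conjugate_gt0 : 0 < ps.
Proof.
rewrite -invr_gt0; have : p^-1 < 1 by rewrite invf_lt1//; move: p1; lra.
move: pps; lra.
Qed.

Lemma conjugate_addM : p + ps = p * ps.
Proof.
have p0 : p != 0 by rewrite gt_eqF//; move: p1; lra.
have ps0 : ps != 0 by rewrite gt_eqF// conjugate_gt0.
have : p * ps * (p^-1 + ps^-1) = p * ps by rewrite pps mulr1.
by rewrite mulrDr mulfK// mulrAC divff// mul1r addrC => <-.
Qed.

Lemma conjugate_gt1 : 1 < ps.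
Proof.
have := conjugate_addM; have := conjugate_gt0; move: p1 => p1' ps0 E.
rewrite -(@ltr_pM2l _ p); nra.
Qed.

Lemma conjugateBM : (p - 1) * ps = p.
Proof. by have := conjugate_addM; lra. Qed.

Lemma conjugateBB : (p - 1) * (ps - 1) = 1.
Proof. by have := conjugate_addM; lra. Qed.

Lemma powR_conjugate (a : R) : (a `^ (p - 1)) `^ ps = a `^ p.
Proof. by rewrite -powRrM conjugateBM. Qed.

Lemma powR_conjugateK (a : R) : 0 <= a -> (a `^ (p - 1)) `^ (ps - 1) = a.
Proof. by move=> a0; rewrite -powRrM conjugateBB powRr1. Qed.

Lemma young (a b : R) : 0 <= a -> 0 <= b ->
  a * b <= p^-1 * a `^ p + ps^-1 * b `^ ps.
Proof.
move=> a0 b0; rewrite [p^-1 * _]mulrC [ps^-1 * _]mulrC.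
apply: conjugate_powR => //; [move: p1; lra|exact: conjugate_gt0].
Qed.

End ConjugateExponents.

Section DualityMap.
Context (R : realType) (V : normedModType R) (p : R).
Local Notation dual V := (blin V R^o).
Hypotheses (V_smooth : uniformly_smooth V) (p1 : 1 < p).

Lemma duality_set_exists_unique (x : V) : exists f : dual V,
  duality_set p x f /\ forall g, duality_set p x g -> g = f.
Proof.
have [->|xn0] := eqVneq x 0.
  exists 0; split=> [|g [_]].
    rewrite /duality_set /= !normr0 mul0r powR0; last by rewrite gt_eqF// subr_gt0.
    by split.
  rewrite normr0 powR0; last by rewrite gt_eqF// subr_gt0.
  by move/eqP; rewrite normr_eq0 => /eqP.
have x0 : 0 < `|x| by rewrite normr_gt0.
set c := `|x| `^ (p - 1); have c0 : 0 < c by rewrite powR_gt0.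
have u1 : `| `|x|^-1 *: x| = 1 by rewrite normrZ normfV normr_id mulVf// gt_eqF.
have [f [fu f1 funiq]] := norming_functional V_smooth u1.
have nf : `|f| = 1.
  apply/eqP; rewrite eq_le f1 -fu (le_trans (dual_le _ _))//.
  by rewrite u1 mulr1.
have fx : f x = `|x|.
  move: fu; rewrite dual_evalZ => /(congr1 (fun z => `|x| * z)).
  by rewrite mulVKf ?gt_eqF// mulr1.
exists (c *: f); split=> [|g [gx gn]].
  by split; rewrite ?dual_scaleE normrZ nf mulr1 (gtr0_norm c0)// fx mulrC.
rewrite -/c in gn.
have -> : g = c *: (c^-1 *: g) by rewrite scalerA divff ?gt_eqF// scale1r.
congr (_ *: _); apply: funiq.
  by rewrite dual_evalZ dual_scaleE gx gn; field; rewrite !gt_eqF.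
by rewrite normrZ gn normfV (gtr0_norm c0) mulVf// gt_eqF.
Qed.

Lemma duality_mapP (x : V) : duality_set p x (duality_map p x).
Proof.
by have [f [fP _]] := duality_set_exists_unique x; exact: xgetI fP.
Qed.

Lemma duality_map_uniq (x : V) f : duality_set p x f -> duality_map p x = f.
Proof.
move=> fP; have [g [_ guniq]] := duality_set_exists_unique x.
by rewrite (guniq _ fP); exact/guniq/duality_mapP.
Qed.

Lemma norm_duality_map (x : V) : `|duality_map p x| = `|x| `^ (p - 1).
Proof. by have [] := duality_mapP x. Qed.

Lemma duality_map_self (x : V) : duality_map p x x = `|x| `^ p.
Proof.
have [-> ->] := duality_mapP x; rewrite mulr_powRB1//.
by move: p1; lra.
Qed.

Lemma to_bidual_inj (x x' : V) : to_bidual x = to_bidual x' -> x = x'.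
Proof.
move=> E; apply/eqP; rewrite -subr_eq0 -normr_eq0.
have := duality_map_self (x - x').
have := congr1 (fun h : dual (dual V) => h (duality_map p (x - x'))) E.
rewrite /= blin_subE => ->; rewrite subrr => /esym/eqP.
by rewrite powR_eq0 => /andP[].
Qed.

End DualityMap.

Section NormAttainment.
Context (R : realType) (X : completeNormedModType R) (p : R).
Local Notation dual V := (blin V R^o).
Hypotheses (p1 : 1 < p) (X_convex : p_convex X p).

Lemma norm_lt_exists (xi : dual X) (e : R) : 0 < e -> e <= `|xi| ->
  exists2 u, `|u| = 1 & `|xi| - e < xi u.
Proof.
move=> e0 exi; apply: contrapT => /forall2NP H.
suff : `|xi| <= `|xi| - e by lra.
have le u : xi u <= (`|xi| - e) * `|u|.
  have [->|un0] := eqVneq u 0; first by rewrite blin_eval0 normr0 mulr0.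
  have u0 : 0 < `|u| by rewrite normr_gt0.
  have [|/negP] := H (`|u|^-1 *: u).
    by rewrite normrZ normfV normr_id mulVf// gt_eqF.
  by rewrite -leNgt dual_evalZ ler_pdivrMl// mulrC.
apply: blin_norm_le => [|u]; first by rewrite subr_ge0.
by rewrite ler_norml le andbT lerNl -[leLHS]blin_oppE -(normrN u) le.
Qed.

(** A maximizing sequence of unit vectors is Cauchy, because the midpoints of its
   terms nearly maximize too and hence have norm close to one, which convexity
   allows only for close terms.  Norm attainment is what reflexivity contributes to
   inverting the duality map. *)
Lemma norm_attained (xi : dual X) : xi != 0 ->
  exists2 u, `|u| = 1 & xi u = `|xi|.
Proof.
move=> xin0; have xi0 : 0 < `|xi| by rewrite normr_gt0.
have [K K0 HK] := X_convex.
have cvx (t : R) (z w : X) : 0 < t -> `|z| = 1 -> `|w| = 1 -> t <= `|z - w| ->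
    K * t `^ p <= 1 - 2^-1 * `|z + w|.
  move=> t0 z1 w1 tzw.
  have t2 : t <= 2 by rewrite (le_trans tzw)// (le_trans (ler_normB _ _))// z1 w1; lra.
  rewrite -lee_fin; apply: (le_trans (HK t _)); first by rewrite t0.
  by apply: ereal_inf_lbound; exists (z, w).
have ex n : exists u, `|u| = 1 /\ `|xi| * (1 - n.+1%:R^-1) < xi u.
  have [||u u1 Hu] := @norm_lt_exists xi (`|xi| * n.+1%:R^-1).
  - by rewrite mulr_gt0.
  - by rewrite ger_pMr// invf_le1// ler1n.
  - by exists u; split=> //; rewrite mulrBr mulr1.
have [u Hu] := choice ex.
have u1 n : `|u n| = 1 by case: (Hu n).
have cauchy_u : cauchy (u @ \oo).
  apply/cauchy_exP => e e0.
  have [K1 HK1] : exists M : nat, forall n, (M <= n)%N -> n.+1%:R^-1 < K * e `^ p.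
    have Ke : 0 < K * e `^ p by rewrite mulr_gt0// powR_gt0.
    have /cvgrPdist_lt/(_ _ Ke) := @cvg_harmonic R.
    move=> [M _ HM]; exists M => n Mn; have := HM n Mn.
    by rewrite /= sub0r normrN ger0_norm.
  exists (u K1), K1 => // n /= Kn; rewrite -ball_normE /= ltNge.
  apply/negP => /(cvx _ _ _ e0 (u1 K1) (u1 n)); apply/negP; rewrite -ltNge.
  have Hm := HK1 _ (leqnn K1); have Hn := HK1 _ Kn; set m := K1 in Hm *.
  suff : 2 - (m.+1%:R^-1 + n.+1%:R^-1) < `|u m + u n|.
    move: Hm Hn; move: (m.+1%:R^-1 : R) (n.+1%:R^-1 : R) (K * _) `|u m + u n|.
    by move=> a b c q; lra.
  rewrite -(ltr_pM2l xi0); apply: lt_le_trans (dual_le _ _).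
  rewrite blin_addE; have [_ um] := Hu m; have [_ un] := Hu n.
  rewrite (_ : `|xi| * _ = `|xi| * (1 - m.+1%:R^-1) + `|xi| * (1 - n.+1%:R^-1)).
    exact: ltrD.
  by ring.
have /cvg_ex[/= l ul] : cvg (u @ \oo) by exact: cauchy_cvg.
have xiu : (xi (u n) : R) @[n --> \oo] --> (xi l : R).
  apply/cvgrPdist_le => e e0.
  have e1 : 0 < e / `|xi| by rewrite divr_gt0.
  have /cvgrPdist_le/(_ _ e1) := ul.
  apply: filterS => n; rewrite -blin_subE => H.
  by rewrite (le_trans (blin_normP _ _))// mulrC -ler_pdivlMr.
exists l.
  have : `|u n| @[n --> \oo] --> `|l| by exact: cvg_norm.
  rewrite (_ : (fun n => `|u n|) = cst 1); last by apply/funext => n; rewrite u1.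
  by move=> /cvg_lim <-//; rewrite lim_cst.
have ln : `|l| <= 1.
  have : `|u n| @[n --> \oo] --> `|l| by exact: cvg_norm.
  rewrite (_ : (fun n => `|u n|) = cst 1); last by apply/funext => n; rewrite u1.
  by move=> /cvg_lim <-//; rewrite lim_cst.
apply/eqP; rewrite eq_le; apply/andP; split.
  by rewrite (le_trans (dual_le _ _))// ger_pMr.
have H : `|xi| * (1 - (n.+1%:R)^-1) @[n --> \oo] --> `|xi| * (1 - 0).
  apply: cvgM; first exact: cvg_cst.
  by apply: cvgB; [exact: cvg_cst|exact: cvg_harmonic].
rewrite subr0 mulr1 in H.
apply: (ler_cvg_to H xiu).
by near=> n; apply: ltW; case: (Hu n).
Unshelve. all: by end_near. Qed.

End NormAttainment.

(** * Bregman distances *)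

Section BregmanGeometry.
Context (R : realType) (X : completeNormedModType R) (p ps : R).
Local Notation dual V := (blin V R^o).
Hypotheses (p1 : 1 < p) (pps : p^-1 + ps^-1 = 1).
Hypotheses (X_convex : p_convex X p) (X_smooth : uniformly_smooth X).
Variable G : R.
Hypothesis G0 : 0 < G.
Hypothesis dual_smooth : forall zs ws : dual X,
  bregman ps p zs ws <= G / ps * `|ws - zs| `^ ps.

Let spp : ps^-1 + p^-1 = 1. Proof. by rewrite addrC. Qed.
Let ps1 : 1 < ps. Proof. exact: conjugate_gt1 pps. Qed.

Lemma norm_duality_mapX (x : X) : `|duality_map p x| `^ ps = `|x| `^ p.
Proof. by rewrite norm_duality_map// (powR_conjugate p1 pps). Qed.

Lemma duality_map_surj (xi : dual X) : exists x : X, duality_map p x = xi.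
Proof.
have [->|xin0] := eqVneq xi 0.
  exists 0; apply: duality_map_uniq => //.
  by split; rewrite !normr0 ?mul0r// powR0// gt_eqF// subr_gt0.
have [u u1 xiu] := norm_attained X_convex xin0.
exists (`|xi| `^ (ps - 1) *: u); apply: duality_map_uniq => //.
have nx : `| `|xi| `^ (ps - 1) *: u| = `|xi| `^ (ps - 1).
  by rewrite normrZ u1 mulr1 ger0_norm// powR_ge0.
split; first by rewrite dual_evalZ nx xiu.
by rewrite nx (powR_conjugateK ps1 spp).
Qed.

Lemma norm_to_bidual (x : X) : `|to_bidual x| = `|x|.
Proof.
apply/eqP; rewrite eq_le; apply/andP; split.
  by apply: blin_norm_le => // f; rewrite mulrC; exact: (blin_normP f x).
have [->|xn0] := eqVneq x 0; first by rewrite normr0.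
have J0 : 0 < `|duality_map p x| by rewrite norm_duality_map// powR_gt0// normr_gt0.
rewrite -(ler_pM2r J0); have [<- _] := duality_mapP X_smooth p1 x.
exact: (dual_le (to_bidual x) (duality_map p x)).
Qed.

Lemma to_bidual_duality_set (x : X) :
  duality_set ps (duality_map p x) (to_bidual x).
Proof.
have [Jx _] := duality_mapP X_smooth p1 x.
split; rewrite norm_to_bidual; first by rewrite /= Jx mulrC.
by rewrite norm_duality_map// (powR_conjugateK p1 pps).
Qed.

(** Every element of the duality set is a subgradient of the convex function
   [ps^-1 * `|.| `^ ps], while the smoothness inequality of the dual space bounds
   that function from above to first order: two such elements coincide. *)
Lemma dual_duality_map (x : X) : duality_map ps (duality_map p x) = to_bidual x.
Proof.
set xi := duality_map p x; set L1 := to_bidual x.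
have [L1xi L1n] := to_bidual_duality_set x.
have [L0xi L0n] : duality_set ps xi (duality_map ps xi).
  exact: xgetI (to_bidual_duality_set x).
set L0 := duality_map ps xi in L0xi L0n *.
have le1 h : L1 h - L0 h <= G / ps * `|h| `^ ps.
  have := dual_smooth xi (xi + h).
  rewrite (_ : xi + h - xi = h); last by rewrite addrAC subrr add0r.
  rewrite /bregman -/L0.
  have : L1 (xi + h) <= p^-1 * `|xi| `^ ps + ps^-1 * `|xi + h| `^ ps.
    rewrite (le_trans (dual_le _ _))// (le_trans (young p1 pps _ _))//.
    by rewrite L1n (powR_conjugate ps1 spp).
  have : L1 xi = L0 xi by rewrite L1xi L0xi L1n L0n.
  rewrite !blin_addE; move: (p^-1 * _) (ps^-1 * _) (G / ps * _) => a b c.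
  move: (L1 xi : R) (L0 xi : R) (L1 h : R) (L0 h : R) => q1 q2 q3 q4 ->; lra.
have le2 h : L1 h - L0 h <= 0.
  have H : G / ps * `|h| `^ ps * t `^ (ps - 1) @[t --> (0 : R)^'+] -->
      G / ps * `|h| `^ ps * 0.
    by apply: cvgM; [exact: cvg_cst|apply: powR_cvg0; rewrite subr_gt0].
  rewrite mulr0 in H; apply: (cvgr_to_ge H); near=> t.
  have t0 : 0 < t by near: t; exact: nbhs_right_gt.
  rewrite -(ler_pM2l t0); have := le1 (t *: h).
  rewrite !dual_evalZ -mulrBr => H1; rewrite (le_trans H1)//.
  rewrite normrZ (gtr0_norm t0) powRM ?(ltW t0)//.
  rewrite -(mulr_powRB1 (ltW t0) (lt_trans ltr01 ps1)).
  by rewrite le_eqVlt; apply/orP; left; apply/eqP; ring.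
apply: blin_ext => h; apply/eqP; rewrite -subr_eq0; apply/eqP/le_anti/andP.
have := le2 h; have := le2 (- h); rewrite !blin_oppE.
by move: (L1 h : R) (L0 h : R) => a b H1 H2; split; lra.
Unshelve. all: by end_near. Qed.

(** On a reflexive space the dual duality map takes values in the range of the
   canonical embedding, and there it inverts the duality map. *)
Lemma duality_mapVK (xi : dual X) :
  duality_map p (of_bidual (duality_map ps xi) : X) = xi.
Proof.
have [x <-] := duality_map_surj xi; rewrite dual_duality_map; congr duality_map.
apply: (to_bidual_inj X_smooth p1).
exact: (@xgetI X 0 [set z | to_bidual z = to_bidual x] x (erefl _)).
Qed.

Lemma bregmanE (z w : X) : bregman p ps z w =
  p^-1 * (`|w| `^ p - `|z| `^ p) + duality_map p z (z - w).
Proof.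
rewrite /bregman blin_subE duality_map_self//.
have -> : ps^-1 = 1 - p^-1 by rewrite -pps addrC addKr.
by move: (duality_map p z w : R) => a; ring.
Qed.

Lemma bregman_self (z : X) : bregman p ps z z = 0.
Proof. by rewrite bregmanE !subrr mulr0 add0r blin_eval0. Qed.

Lemma bregman_three_points (x z w : X) : bregman p ps x z =
  bregman p ps x w - bregman p ps z w +
  (duality_map p z - duality_map p x) (z - w).
Proof.
rewrite dual_subE /bregman !blin_subE duality_map_self//.
have -> : ps^-1 = 1 - p^-1 by rewrite -pps addrC addKr.
move: (duality_map p z w : R) (duality_map p x w : R) (duality_map p x z : R) => a b c.
by ring.
Qed.

(** Smoothness of the dual bounds the conjugate norm power from above near [J z];
   by the Young inequality between [w] and [J z + h] this bounds the norm power at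
   [w], and with it the Bregman distance, from below. *)
Lemma bregman_ge_dual (z w : X) (h : dual X) :
  h (w - z) - G / ps * `|h| `^ ps <= bregman p ps z w.
Proof.
have := dual_smooth (duality_map p z) (duality_map p z + h).
rewrite [_ + h - _]addrAC subrr add0r /bregman dual_duality_map norm_duality_mapX.
have := dual_le (duality_map p z + h) w.
have := young p1 pps (normr_ge0 w) (normr_ge0 (duality_map p z + h)).
rewrite !to_bidualE !dual_addE blin_subE duality_map_self//.
have -> : ps^-1 = 1 - p^-1 by rewrite -pps addrC addKr.
rewrite (mulrC `|w|).
move: (`|duality_map p z + h| * _) (_ * `|duality_map p z + h| `^ _) (G * _ * _).
move: (duality_map p z w : R) (h w : R) (h z : R) => a b c d e f.
rewrite mulrBl mul1r; lra.
Qed.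

(** Optimizing over [h]: smoothness of power type [ps] in the dual makes the norm
   power uniformly convex of power type [p], so Bregman convergence implies norm
   convergence. *)
Lemma bregman_ge : exists2 c, 0 < c &
  forall z w : X, c * `|z - w| `^ p <= bregman p ps z w.
Proof.
have ps0 : 0 < ps by exact: conjugate_gt0 pps.
(* the left-hand side of the dual lower bound is largest when [h] is the multiple
   [G `^ (1 - p)] of the duality map at [w - z] *)
exists (G `^ (1 - p) / p) => [|z w].
  by rewrite divr_gt0 ?powR_gt0//; move: p1; lra.
apply: le_trans (bregman_ge_dual z w (G `^ (1 - p) *: duality_map p (w - z))).
rewrite dual_scaleE duality_map_self// normrZ ger0_norm ?powR_ge0//.
rewrite powRM ?powR_ge0// norm_duality_mapX distrC -powRrM.
have E : G * G `^ ((1 - p) * ps) = G `^ (1 - p).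
  rewrite -{1}(powRr1 (ltW G0)) -powRD; last by apply/implyP => _; rewrite gt_eqF.
  by congr (_ `^ _); have := conjugateBM p1 pps; lra.
rewrite (_ : G / ps * _ = ps^-1 * (G * G `^ ((1 - p) * ps)) * `|w - z| `^ p); last by ring.
rewrite E (_ : ps^-1 = 1 - p^-1); last by rewrite -pps addrC addKr.
by rewrite le_eqVlt; apply/orP; left; apply/eqP; ring.
Qed.

Lemma bregman_ge0 (z w : X) : 0 <= bregman p ps z w.
Proof.
by have [c c0 H] := bregman_ge; rewrite (le_trans _ (H z w))// mulr_ge0 ?powR_ge0// ltW.
Qed.

(** The symmetrized distance is a pairing of dual and primal differences, hence
   controlled by the norm distance on bounded sets. *)
Lemma bregman_le (z w : X) :
  bregman p ps z w <= (`|z| `^ (p - 1) + `|w| `^ (p - 1)) * `|z - w|.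
Proof.
have sumE : bregman p ps z w + bregman p ps w z =
    duality_map p z (z - w) - duality_map p w (z - w).
  rewrite !bregmanE -(opprB z w) blin_oppE.
  by move: (duality_map p z (z - w) : R) (duality_map p w (z - w) : R) => a b; ring.
have H : duality_map p z (z - w) <= `|z| `^ (p - 1) * `|z - w|.
  by rewrite -norm_duality_map// dual_le.
have H' : - duality_map p w (z - w) <= `|w| `^ (p - 1) * `|z - w|.
  by rewrite -norm_duality_map// -blin_oppE -(normrN (z - w)) dual_le.
have := bregman_ge0 w z; rewrite mulrDl; move: sumE H H'.
move: (duality_map p z (z - w) : R) (duality_map p w (z - w) : R) => a b; lra.
Qed.

Lemma bregman_cvg0_norm (u : nat -> X) (x : X) :
  bregman p ps (u n) x @[n --> \oo] --> (0 : R) ->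
  `|u n - x| @[n --> \oo] --> (0 : R).
Proof.
move=> ux; have [c c0 H] := bregman_ge.
apply/cvgrPdist_lt => e e0.
have ce0 : 0 < c * e `^ p by rewrite mulr_gt0// powR_gt0.
have /cvgrPdist_lt/(_ _ ce0) := ux.
apply: filterS => n; rewrite !sub0r !normrN normr_id ger0_norm ?bregman_ge0// => Hn.
have := le_lt_trans (H _ _) Hn; rewrite ltr_pM2l//.
rewrite !ltNge; apply: contraNN => eu.
by rewrite ge0_ler_powR ?nnegrE// ltW//; move: p1; lra.
Qed.

Lemma norm_cvg_bregman0 (u : nat -> X) (x : X) :
  u n @[n --> \oo] --> x -> bregman p ps (u n) x @[n --> \oo] --> (0 : R).
Proof.
move=> ux; set m := (`|x| + 1) `^ (p - 1).
have m0 : 0 <= m by exact: powR_ge0.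
have d0 : `|u n - x| @[n --> \oo] --> (0 : R).
  rewrite -(@normr0 _ X) -(subrr x); apply: cvg_norm.
  by apply: cvgB => //; exact: cvg_cst.
have H : (m + m) * `|u n - x| @[n --> \oo] --> (m + m) * 0.
  by apply: cvgM => //; exact: cvg_cst.
rewrite mulr0 in H; apply: (squeeze_cvgr _ (cvg_cst 0) H).
have /cvgrPdist_lt/(_ _ ltr01) := d0.
apply: filterS => n; rewrite sub0r normrN normr_id bregman_ge0/= => un1.
rewrite (le_trans (bregman_le _ _))// ler_wpM2r//.
have pow_le (a : R) : 0 <= a -> a <= `|x| + 1 -> a `^ (p - 1) <= m.
  by move=> a0 am; rewrite ge0_ler_powR ?nnegrE ?subr_ge0 ?(ltW p1)// addr_ge0.
rewrite lerD// pow_le//; last by rewrite lerDl.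
by rewrite -lerBlDl (le_trans (lerB_dist _ _))// ltW.
Qed.

(** The change of distance to [w] is affine in the dual step [g] up to the Bregman
   distance between the dual iterates, which dual smoothness bounds. *)
Lemma bregman_step (x x' w : X) (g : dual X) :
  duality_map p x' = duality_map p x - g ->
  bregman p ps x' w <= bregman p ps x w - g (x - w) + G / ps * `|g| `^ ps.
Proof.
move=> Jx'; have := dual_smooth (duality_map p x) (duality_map p x').
have -> : duality_map p x' - duality_map p x = - g by rewrite Jx' addrAC subrr add0r.
rewrite normrN /bregman dual_duality_map !norm_duality_mapX to_bidualE.
rewrite Jx' !dual_subE !blin_subE duality_map_self//.
have -> : ps^-1 = 1 - p^-1 by rewrite -pps addrC addKr.
move: (G * _ * _) (duality_map p x w : R) (g w : R) (g x : R) => a b c d.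
rewrite !mulrBl !mul1r; lra.
Qed.

End BregmanGeometry.

(** * Pathwise analysis of the iteration *)

Section Adjoint.
Context (R : realType) (V W : normedModType R).
Local Notation dual V := (blin V R^o).

Lemma adjointE (A : blin V W) (f : dual W) x : adjoint A f x = f (A x).
Proof. by []. Qed.

Lemma norm_adjoint_le (A : blin V W) (f : dual W) :
  `|adjoint A f| <= `|A| * `|f|.
Proof.
apply: blin_norm_le => [|x]; first by rewrite mulr_ge0.
rewrite adjointE (le_trans (blin_normP f _))// mulrC (mulrC `|A|) -mulrA.
by rewrite (mulrC `|f|) ler_wpM2r// blin_normP.
Qed.

End Adjoint.

Section Iteration.
Context (R : realType) (X : completeNormedModType R) (p ps : R).
Local Notation dual V := (blin V R^o).
Hypotheses (p1 : 1 < p) (pps : p^-1 + ps^-1 = 1).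
Hypotheses (X_convex : p_convex X p) (X_smooth : uniformly_smooth X).
Variable G : R.
Hypothesis G0 : 0 < G.
Hypothesis dual_smooth : forall zs ws : dual X,
  bregman ps p zs ws <= G / ps * `|ws - zs| `^ ps.
Context (N : nat) (Y : 'I_N -> normedModType R).
Variable j : forall i, Y i -> dual (Y i).
Hypothesis jP : forall i u, duality_set p u (@j i u).
Variables (F : forall i, X -> Y i) (y : forall i, Y i) (S : set X).
Variable dF : forall i, X -> blin X (Y i).
Variables (Lmax gamma : R).
Hypothesis Lmax_ge : forall i x, S x -> `|dF i x| <= Lmax.
Hypothesis gamma01 : 0 < gamma < 1.
Hypothesis cone : forall i x x', S x -> S x' ->
  `|F i x - F i x' - dF i x (x - x')| <= gamma * `|F i x - F i x'|.
Variable mu : nat -> R.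
Hypothesis mu_gt0 : forall k, 0 < mu k.
Variable C : R.
Hypothesis C0 : 0 < C.
Hypothesis mu_small : forall k,
  C <= 1 - gamma - Lmax `^ ps * (G / ps) * mu k `^ (ps - 1).

Local Notation J := (duality_map p).
Local Notation B := (bregman p ps).

Definition solution_in (x : X) : Prop := S x /\ forall i, F i x = y i.

Lemma cone_le i x x' : S x -> S x' ->
  `|dF i x (x - x')| <= (1 + gamma) * `|F i x - F i x'|.
Proof.
move=> Sx Sx'; have := cone i Sx Sx'.
have := lerB_dist (dF i x (x - x')) (F i x - F i x').
rewrite distrC mulrDl mul1r; lra.
Qed.

Lemma cone_ge i x x' : S x -> S x' ->
  (1 - gamma) * `|F i x - F i x'| <= `|dF i x (x - x')|.
Proof.
move=> Sx Sx'; have := cone i Sx Sx'.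
have := lerB_dist (F i x - F i x') (dF i x (x - x')).
rewrite mulrBl mul1r; lra.
Qed.

Lemma duality_set_norm i u : `|@j i u| = `|u| `^ (p - 1).
Proof. by have [_ ->] := @jP i u. Qed.

Lemma duality_set_self i u : @j i u u = `|u| `^ p.
Proof. by have [-> ->] := @jP i u; rewrite mulr_powRB1//; move: p1; lra. Qed.

(** The update direction: [m] times the gradient of the residual functional of
   the [i]-th equation. *)
Definition update (m : R) i (x : X) : dual X :=
  m *: adjoint (dF i x) (j (F i x - y i)).

Lemma updateE m i x h : update m i x h = m * j (F i x - y i) (dF i x h).
Proof. by []. Qed.

(** The cone condition makes the residual functional almost convex at a
   solution, which yields [- (1 - gamma)] in the first-order term; the step size
   bound absorbs the second-order term. *)
Lemma descent_step k i (x x' xh : X) : S x -> solution_in xh ->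
  J x' = J x - update (mu k) i x ->
  B x' xh <= B x xh - mu k * (C * `|F i x - y i| `^ p).
Proof.
move=> Sx [Sxh Fxh] Jx'.
have := bregman_step p1 pps X_smooth dual_smooth xh Jx'.
set u := F i x - y i; set f := j u.
have p0 : 0 < p by move: p1; lra.
have ps0 : 0 < ps := conjugate_gt0 p1 pps.
have L0 : 0 <= Lmax by exact: le_trans (Lmax_ge i Sx).
have up : `|u| * `|u| `^ (p - 1) = `|u| `^ p by rewrite mulr_powRB1.
have first_order : (1 - gamma) * `|u| `^ p <= f (dF i x (x - xh)).
  have fc : f (u - dF i x (x - xh)) <= gamma * `|u| `^ p.
    rewrite (le_trans (dual_le _ _))// duality_set_norm mulrC -up mulrA.
    by rewrite ler_wpM2r ?powR_ge0// /u -(Fxh i) cone.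
  move: fc; rewrite blin_subE duality_set_self mulrBl mul1r.
  by move: (f _ : R) => a; lra.
have second_order : `|update (mu k) i x| `^ ps <= mu k `^ ps * (Lmax `^ ps * `|u| `^ p).
  rewrite normrZ (gtr0_norm (mu_gt0 k)) powRM ?(ltW (mu_gt0 k))//.
  rewrite ler_wpM2l ?powR_ge0// -(powR_conjugate p1 pps) -powRM ?powR_ge0//.
  rewrite ge0_ler_powR ?nnegrE ?mulr_ge0 ?powR_ge0 ?(ltW ps0)//.
  rewrite (le_trans (norm_adjoint_le _ _))// duality_set_norm.
  by rewrite ler_wpM2r ?powR_ge0// Lmax_ge.
rewrite updateE -/u -/f => H; apply: (le_trans H).
have H1 : mu k * ((1 - gamma) * `|u| `^ p) <= mu k * f (dF i x (x - xh)).
  by rewrite ler_pM2l.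
have H2 : G / ps * `|update (mu k) i x| `^ ps <=
    G / ps * (mu k `^ ps * (Lmax `^ ps * `|u| `^ p)).
  by rewrite ler_wpM2l// ltW// divr_gt0.
have H3 : mu k * (`|u| `^ p * C) <=
   mu k * (`|u| `^ p * (1 - gamma - Lmax `^ ps * (G / ps) * mu k `^ (ps - 1))).
  by rewrite ler_pM2l// ler_wpM2l// powR_ge0.
rewrite -(mulr_powRB1 (ltW (mu_gt0 k)) ps0) in H2.
have E : mu k * (`|u| `^ p * (1 - gamma - Lmax `^ ps * (G / ps) * mu k `^ (ps - 1))) =
  mu k * ((1 - gamma) * `|u| `^ p) -
  G / ps * (mu k * mu k `^ (ps - 1) * (Lmax `^ ps * `|u| `^ p)) by ring.
rewrite E in H3; rewrite (mulrC C).
move: (f _ : R) H1 H2 H3 => a H1 H2 H3; lra.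
Qed.

Let decrease_ge0 k (a : R) : 0 <= mu k * (C * a `^ p).
Proof. by apply: mulr_ge0; [exact: ltW|rewrite mulr_ge0 ?powR_ge0 ?ltW]. Qed.

Variables (x0 xd : X) (nu : R).
Hypothesis ball_sub : bregman_ball p ps xd nu `<=` S.
Hypothesis nu0 : 0 < nu.
Hypothesis xdE : forall i, F i xd = y i.
Hypothesis x0_ball : bregman_ball p ps xd nu x0.

Section Path.
Variable idx : nat -> 'I_N.
Local Notation x := (sgd p ps F dF j y mu x0 idx).

Lemma duality_map_sgdS k : J (x k.+1) = J (x k) - update (mu k) (idx k) (x k).
Proof. exact: (duality_mapVK p1 pps X_convex X_smooth dual_smooth). Qed.

Lemma xd_solution : solution_in xd.
Proof.
split=> //; apply: ball_sub; rewrite /bregman_ball /= bregman_self//; exact: ltW.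
Qed.

(** Staying in the ball, hence in the region where the conditions on the operators
   hold, is part of the descent: each step needs the previous one to be there. *)
Lemma sgd_ball k : bregman_ball p ps xd nu (x k).
Proof.
elim: k => [//|k IH]; rewrite /bregman_ball /=.
have Sx : S (x k) by exact: ball_sub.
apply: le_trans (descent_step Sx xd_solution (duality_map_sgdS k)) _.
by apply: le_trans IH; rewrite lerBlDr lerDl decrease_ge0.
Qed.

Lemma sgd_in k : S (x k).
Proof. exact/ball_sub/sgd_ball. Qed.

Lemma sgd_descent xh k : solution_in xh ->
  B (x k.+1) xh <= B (x k) xh - mu k * (C * `|F (idx k) (x k) - y (idx k)| `^ p).
Proof. by move=> sol; exact: descent_step (sgd_in k) sol (duality_map_sgdS k). Qed.

Lemma sgd_bregman_noninc xh k n : solution_in xh -> (k <= n)%N ->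
  B (x n) xh <= B (x k) xh.
Proof.
move=> sol; elim: n => [|n IH]; first by rewrite leqn0 => /eqP ->.
rewrite leq_eqVlt => /predU1P[->//|/IH]; apply: le_trans.
apply: (le_trans (sgd_descent _ sol)).
by rewrite lerBlDr lerDl decrease_ge0.
Qed.

Lemma sgd_sum_residuals n :
  \sum_(0 <= k < n) mu k * `|F (idx k) (x k) - y (idx k)| `^ p <= nu / C.
Proof.
rewrite ler_pdivlMr// mulr_suml.
suff : \sum_(0 <= k < n) mu k * `|F (idx k) (x k) - y (idx k)| `^ p * C <=
    B (x 0) xd - B (x n) xd.
  move=> H; apply: (le_trans H).
  have := bregman_ge0 p1 pps X_smooth G0 dual_smooth (x n) xd.
  have : B (x 0) xd <= nu by exact: x0_ball.
  by lra.
elim: n => [|n IH]; first by rewrite big_geq// subrr.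
rewrite big_nat_recr//=; have := sgd_descent n xd_solution.
rewrite [C * _]mulrC mulrA; move: IH => /=; lra.
Qed.

Definition max_residual (z : X) : R := \big[Num.max/0]_(i < N) `|F i z - y i|.

Lemma residual_le_max i z : `|F i z - y i| <= max_residual z.
Proof. by rewrite /max_residual (bigD1 i)//= le_max lexx. Qed.

Lemma max_residual_ge0 z : 0 <= max_residual z.
Proof. by rewrite /max_residual; elim/big_ind: _ => // a b a0 b0; rewrite le_max a0. Qed.

Lemma max_residual_pow_le z :
  max_residual z `^ p <= \sum_(i < N) `|F i z - y i| `^ p.
Proof.
have p0 : p != 0 by rewrite gt_eqF//; move: p1; lra.
have s0 : 0 <= \sum_(i < N) `|F i z - y i| `^ p.
  by apply: sumr_ge0 => i _; exact: powR_ge0.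
rewrite /max_residual; elim/big_ind : _ => [||i _].
- by rewrite powR0.
- by move=> a b ha hb; rewrite /Num.max; case: ifP.
- by rewrite (bigD1 i)//= lerDl sumr_ge0// => k _; exact: powR_ge0.
Qed.

Local Notation res k := (max_residual (x k)).

(** Each dual step pairs with [x k - xd] through the derivative at [x n], which the
   cone condition bounds by the residuals at [x n] and [x k].  The residual at [k]
   is a running minimum, so the former alone suffices: three times, twice for
   [x n - xd] and [x n - x k], once for [x k]. *)
Lemma dual_increment l k : (l <= k)%N ->
  (forall n, (n < k)%N -> res k <= res n) ->
  `|(J (x k) - J (x l)) (x k - xd)| <=
  3 * (1 + gamma) * \sum_(l <= n < k) mu n * res n `^ p.
Proof.
move=> lk rec.
have step n : (n < k)%N ->
    `|update (mu n) (idx n) (x n) (x k - xd)| <= 3 * (1 + gamma) * (mu n * res n `^ p).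
  move=> nk; set i := idx n.
  have p0 : 0 < p by move: p1; lra.
  have g0 : 0 <= 1 + gamma by case/andP: gamma01 => *; lra.
  rewrite updateE normrM (gtr0_norm (mu_gt0 n)) mulrCA ler_pM2l//.
  rewrite -(mulr_powRB1 (max_residual_ge0 _) p0) mulrA mulrC.
  apply: (le_trans (blin_normP _ _)); rewrite duality_set_norm.
  apply: ler_pM => //.
    rewrite ge0_ler_powR ?nnegrE ?max_residual_ge0 ?residual_le_max//.
    by rewrite subr_ge0 ltW.
  rewrite (_ : x k - xd = (x n - xd) - (x n - x k)); last by rewrite opprB [RHS]addrC subrKA.
  rewrite blin_subE (le_trans (ler_normB _ _))//.
  have H1 := cone_le i (sgd_in n) xd_solution.1.
  have H2 := cone_le i (sgd_in n) (sgd_in k).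
  apply: (le_trans (lerD H1 H2)); rewrite -mulrDr (mulrC 3) -mulrA.
  rewrite ler_wpM2l// xdE.
  have : `|F i (x n) - F i (x k)| <= `|F i (x n) - y i| + `|F i (x k) - y i|.
    by rewrite -[in leLHS](subrKA (y i)) (distrC (F i (x k))) ler_normD.
  have := residual_le_max i (x n); have := residual_le_max i (x k).
  have := rec n nk; lra.
suff H t : (l <= t <= k)%N -> `|(J (x t) - J (x l)) (x k - xd)| <=
    3 * (1 + gamma) * \sum_(l <= n < t) mu n * res n `^ p.
  by apply: H; rewrite lk leqnn.
elim: t => [|t IH].
  by rewrite leqn0 => /andP[/eqP -> _]; rewrite subrr normr0 big_geq// mulr0.
rewrite leq_eqVlt => /andP[/predU1P[<- _|lt tk]].
  by rewrite subrr normr0 big_geq// mulr0.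
rewrite duality_map_sgdS addrAC dual_subE big_nat_recr//= mulrDr.
rewrite (le_trans (ler_normB _ _))// lerD ?step// IH//.
by rewrite -ltnS lt ltnW.
Qed.

Variable M : R.
Hypothesis residuals_summable : forall n,
  \sum_(0 <= k < n) mu k * res k `^ p <= M.
Hypothesis mu_diverges : forall A : R, exists n, A < \sum_(0 <= k < n) mu k.

Let p_gt0 : 0 < p. Proof. exact: lt_trans p1. Qed.

(** Otherwise the divergent step sizes would make the weighted sum diverge. *)
Lemma small_residual (e : R) K : 0 < e -> exists2 n, (K <= n)%N & res n < e.
Proof.
move=> e0; apply: contrapT => /forall2NP H.
have ge n : (K <= n)%N -> e <= res n.
  by move=> Kn; have [//|/negP] := H n; rewrite -leNgt.
have ep0 : 0 < e `^ p by rewrite powR_gt0.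
have [n] := mu_diverges (\sum_(0 <= k < K) mu k + M / e `^ p).
apply/negP; rewrite -leNgt -lerBlDl ler_pdivlMr//.
have [nK|Kn] := leqP n K.
  have M0 : 0 <= M by have := residuals_summable 0; rewrite big_geq.
  apply: le_trans M0; rewrite pmulr_lle0// subr_le0 (big_cat_nat (leq0n n) nK)//= lerDl.
  by apply: sumr_ge0 => k _; exact: ltW.
rewrite (big_cat_nat (leq0n K) (ltnW Kn))//= addrAC subrr add0r mulr_suml.
apply: le_trans (residuals_summable n); rewrite [leRHS](big_cat_nat (leq0n K) (ltnW Kn))//=.
rewrite -[leLHS]add0r lerD//.
  by apply: sumr_ge0 => k _; rewrite mulr_ge0 ?powR_ge0// ltW.
rewrite big_nat [leRHS]big_nat; apply: ler_sum => k /andP[Kk _].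
rewrite ler_pM2l// ge0_ler_powR ?nnegrE ?max_residual_ge0 ?ge// ltW//.
Qed.

(** Residuals that never vanish stay away from zero on any initial segment, so the
   minimizer over a range that ends at a much smaller residual lies beyond that
   segment. *)
Lemma record_residual (e : R) K : (forall k, res k != 0) -> 0 < e ->
  exists n, [/\ (K <= n)%N, res n < e & forall k, (k < n)%N -> res n <= res k].
Proof.
move=> resn0 e0.
have res0 k : 0 < res k by rewrite lt_def resn0 max_residual_ge0.
have [e' e'0 [e'e e'min]] : exists2 e' : R, 0 < e' &
    e' <= e /\ forall k, (k < K)%N -> e' <= res k.
  elim: K => [|K [a a0 [ae amin]]]; first by exists e.
  exists (Num.min a (res K)); first by rewrite lt_min a0 res0.
  split=> [|k]; first by rewrite ge_min ae.
  by rewrite ltnS leq_eqVlt ge_min => /predU1P[->|/amin ->//]; rewrite lexx orbT.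
have [n' Kn' n'e] := small_residual K e'0.
case: (@arg_minP _ _ _ (@ord_max n') xpredT (fun i : 'I_n'.+1 => res i) isT).
move=> n _ nmin; exists n.
have nn' : res n <= res n' by exact: (nmin ord_max).
split; last 2 first.
- by rewrite (le_lt_trans nn')// (lt_le_trans n'e).
- by move=> k kn; exact: (nmin (Ordinal (ltn_trans kn (ltn_ord n)))).
rewrite leqNgt; apply/negP => /e'min; apply/negP; rewrite -ltNge.
exact: le_lt_trans nn' n'e.
Qed.

(* along records the Bregman distance between two iterates is at most the
   decrement of this bounded nonincreasing sequence *)
Let potential n := B (x n) xd -
  3 * (1 + gamma) * \sum_(0 <= k < n) mu k * res k `^ p.

Let bregman_records l k : (l <= k)%N -> (forall n, (n < k)%N -> res k <= res n) ->
  B (x l) (x k) <= B (x l) xd - B (x k) xd + 3 * (1 + gamma) *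
    \sum_(l <= n < k) mu n * res n `^ p.
Proof.
move=> lk rec; rewrite (bregman_three_points p1 pps X_smooth _ _ xd) lerD2l.
by rewrite (le_trans (ler_norm _))// dual_increment.
Qed.

Let potential_small (e : R) : 0 < e ->
  exists n0, forall l k, (n0 <= l)%N -> (n0 <= k)%N ->
    potential l - potential k < e.
Proof.
move=> e0; have c0 : 0 <= 3 * (1 + gamma) by case/andP: gamma01 => *; lra.
have noninc : nonincreasing_seq potential.
  apply/nonincreasing_seqP => n; rewrite /potential big_nat_recr//=.
  rewrite lerB//; first exact: (sgd_bregman_noninc xd_solution (leqnSn n)).
  by rewrite ler_wpM2l// lerDl mulr_ge0 ?powR_ge0// ltW.
have lb : has_lbound (range potential).
  exists (- (3 * (1 + gamma) * M)) => _ [n _ <-]; rewrite -[leLHS]add0r.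
  rewrite lerB//; last exact: ler_wpM2l.
  exact: (bregman_ge0 p1 pps X_smooth G0 dual_smooth).
have /cvg_ex[/= v Hv] := nonincreasing_is_cvgn noninc lb.
have e20 : 0 < e / 2 by rewrite divr_gt0.
have /cvgrPdist_lt/(_ _ e20)[n0 _ Hn0] := Hv; exists n0 => l k ln kn.
have := Hn0 l ln; have := Hn0 k kn; rewrite /= !ltr_norml => /andP[? ?] /andP[? ?].
lra.
Qed.

(** Iterates at records of the residual form a Cauchy sequence, by the three-point
   identity; its limit has zero residual.  The distance to that limit decreases
   along the whole path, so it tends to zero.  An iterate with
   vanishing residual is itself such a limit. *)
Theorem sgd_path_cvg : closed S -> exists2 xh, solution_in xh &
  B (x n) xh @[n --> \oo] --> (0 : R).
Proof.
move=> closedS.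
have Bge0 := bregman_ge0 p1 pps X_smooth G0 dual_smooth.
(* by monotonicity it is enough to come close to a solution once *)
have close xh : solution_in xh -> (forall e : R, 0 < e -> exists n, B (x n) xh < e) ->
    B (x n) xh @[n --> \oo] --> (0 : R).
  move=> sol H; apply/cvgrPdist_lt => e e0; have [n0 Hn0] := H e e0.
  exists n0 => // n /= n0n; rewrite sub0r normrN ger0_norm//.
  exact: le_lt_trans (sgd_bregman_noninc sol n0n) Hn0.
have [[k0 resk0]|resn0] := pselect (exists k, res k = 0).
  have sol : solution_in (x k0).
    split=> [|i]; first exact: sgd_in.
    apply/eqP; rewrite -subr_eq0 -normr_le0 -resk0; exact: residual_le_max.
  exists (x k0) => //; apply: close => // e e0; exists k0.
  by rewrite bregman_self.
have ex k : exists n, [/\ (k <= n)%N, res n < k.+1%:R^-1 &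
    forall i, (i < n)%N -> res n <= res i].
  apply: record_residual => // i; apply/eqP => ri; apply: resn0; by exists i.
have [s Hs] := choice ex.
have [c c0 Bge] := bregman_ge p1 pps X_smooth G0 dual_smooth.
have cauchy_s : cauchy ((x \o s) @ \oo).
  apply/cauchy_exP => e e0.
  have ce0 : 0 < c * e `^ p by rewrite mulr_gt0// powR_gt0.
  have [n0 Hn0] := potential_small ce0.
  have records_close a b : (n0 <= s a)%N -> (s a <= s b)%N -> `|x (s a) - x (s b)| < e.
    move=> na ab; have nb := leq_trans na ab.
    have [_ _ recb] := Hs b.
    have := le_trans (Bge (x (s a)) (x (s b))) (bregman_records ab recb).
    have := Hn0 _ _ na nb; rewrite /potential.
    rewrite [X in _ - (_ - _ * X)](big_cat_nat (leq0n _) ab)/= => H1 H2.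
    have : c * `|x (s a) - x (s b)| `^ p < c * e `^ p by lra.
    rewrite ltr_pM2l// !ltNge; apply: contraNN => eu.
    by rewrite ge0_ler_powR ?nnegrE// ltW.
  exists (x (s n0)), n0 => // n /= n0n; rewrite -ball_normE /=.
  have [sn0 _ _] := Hs n0; have [sn _ _] := Hs n.
  have [le|/ltnW le] := leqP (s n0) (s n); first exact: records_close.
  by rewrite distrC; apply: records_close => //; exact: leq_trans n0n sn.
have /cvg_ex[/= xh xsh] : cvg ((x \o s) @ \oo) by exact: cauchy_cvg.
have Sxh : S xh.
  apply: (@closed_cvg _ _ _ _ (x \o s) S closedS _ xh xsh).
  by apply: nearW => k /=; exact: sgd_in.
have solxh : solution_in xh.
  split=> // i; apply/eqP; rewrite -subr_eq0 -normr_le0.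
  have g1 : 0 < 1 - gamma by case/andP: gamma01 => *; lra.
  have d0 : `|x (s k) - xh| @[k --> \oo] --> (0 : R).
    rewrite -(@normr0 _ X) -(subrr xh); apply: cvg_norm.
    by apply: cvgB => //; exact: cvg_cst.
  have H : Lmax / (1 - gamma) * `|x (s k) - xh| + k.+1%:R^-1 @[k --> \oo] -->
      Lmax / (1 - gamma) * 0 + (0 : R).
    apply: cvgD; last exact: cvg_harmonic.
    by apply: cvgM => //; exact: cvg_cst.
  rewrite mulr0 addr0 in H; apply: (cvgr_to_ge H); apply: nearW => k.
  have -> : F i xh - y i = (F i (x (s k)) - y i) - (F i (x (s k)) - F i xh).
    by rewrite opprB [RHS]addrC subrKA.
  rewrite (le_trans (ler_normB _ _))// addrC lerD//.
    rewrite mulrAC ler_pdivlMr// mulrC.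
    apply: (le_trans (cone_ge i (sgd_in _) Sxh)).
    by rewrite (le_trans (blin_normP _ _))// ler_wpM2r// Lmax_ge//; exact: sgd_in.
  have [_ /ltW rk _] := Hs k; apply: le_trans rk; exact: residual_le_max.
exists xh => //; apply: close => // e e0.
have /cvgrPdist_lt/(_ _ e0)[k _ Hk] := norm_cvg_bregman0 p1 pps X_smooth G0 dual_smooth xsh.
by exists (s k); have := Hk k (leqnn k); rewrite /= sub0r normrN ger0_norm.
Qed.

(** All dual steps annihilate the common null space of the derivatives at [xmd],
   and by the cone condition [xmd - xh] lies in it.  Hence the difference of the
   Bregman distances to [xmd] and [xh] is the same at every iterate as at [x0],
   where it is nonpositive by minimality. *)
Lemma sgd_min_distance_cvg xh xmd : solution_in xh -> solution_in xmd ->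
  B x0 xmd <= B x0 xh ->
  (forall z, S z -> forall h, (forall i, dF i xmd h = 0) -> forall i, dF i z h = 0) ->
  B (x n) xh @[n --> \oo] --> (0 : R) -> B (x n) xmd @[n --> \oo] --> (0 : R).
Proof.
move=> [Sxh Fxh] [Sxmd Fxmd] le_dist null_sub xnh.
have null_h i : dF i xmd (xmd - xh) = 0.
  apply/eqP; rewrite -normr_le0 (le_trans (cone_le i Sxmd Sxh))//.
  by rewrite Fxmd Fxh subrr normr0 mulr0.
have J_const n : J (x n) (xmd - xh) = J x0 (xmd - xh).
  elim: n => [//|n <-]; rewrite duality_map_sgdS dual_subE updateE.
  by rewrite null_sub// ?blin_eval0 ?mulr0 ?subr0//; exact: sgd_in.
have diff z : B z xmd - B z xh =
    p^-1 * (`|xmd| `^ p - `|xh| `^ p) - J z (xmd - xh).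
  rewrite /bregman blin_subE.
  by move: (J z xmd : R) (J z xh : R) => a b; ring.
apply: (squeeze_cvgr _ (cvg_cst 0) xnh); apply: nearW => n.
rewrite (bregman_ge0 p1 pps X_smooth G0 dual_smooth)/=.
rewrite -subr_le0 diff J_const -diff subr_le0; exact: le_dist.
Qed.

End Path.
End Iteration.

(** * Sampling of the indices *)

Section FirstIndices.
Context (N : nat) (A : Type).

Definition depends_on_first (k : nat) (phi : (nat -> 'I_N) -> A) : Prop :=
  forall a b, (forall n, (n < k)%N -> a n = b n) -> phi a = phi b.

Definition set_index (a : nat -> 'I_N) (k : nat) (i : 'I_N) : nat -> 'I_N :=
  fun n => if n == k then i else a n.

Lemma depends_on_first_set_index k i phi : depends_on_first k.+1 phi ->
  depends_on_first k (fun a => phi (set_index a k i)).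
Proof.
move=> dep a b ab; apply: dep => n; rewrite ltnS leq_eqVlt /set_index.
by case: eqP => //= _; exact: ab.
Qed.

Lemma set_index_id (a : nat -> 'I_N) k : set_index a k (a k) = a.
Proof. by apply/funext => n; rewrite /set_index; case: eqP => // ->. Qed.

End FirstIndices.

Section IndependentIndices.
Context (d : measure_display) (T : measurableType d) (R : realType).
Context (P : probability T R) (N : nat) (idx : nat -> T -> 'I_N).
Hypothesis N0 : (0 < N)%N.
Hypothesis idxP : iid_uniform P idx.

Let idx_measurable k i : measurable (idx k @^-1` [set i]).
Proof. by case: idxP. Qed.

(** Splitting according to the value of the last index involved removes the
   dependence on it, so that finitely many cylinders describe the preimage of any
   set, measurable or not. *)
Lemma measurable_first (A : Type) k (phi : (nat -> 'I_N) -> A) (Q : set A) :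
  depends_on_first k phi -> measurable [set w | Q (phi (idx ^~ w))].
Proof.
elim: k phi => [|k IH] phi dep.
  have E w : phi (idx ^~ w) = phi (fun=> Ordinal N0) by exact: dep.
  have [q|nq] := pselect (Q (phi (fun=> Ordinal N0))).
    rewrite (_ : [set w | _] = setT)//; apply/seteqP; split=> w //= _.
    by rewrite E.
  rewrite (_ : [set w | _] = set0)//; apply/seteqP; split=> w //=.
  by rewrite E.
rewrite (_ : [set w | _] = \big[setU/set0]_(i < N) (idx k @^-1` [set i] `&`
    [set w | Q (phi (set_index (idx ^~ w) k i))])).
  apply: bigsetU_measurable => i _; apply: measurableI => //.
  exact: IH (depends_on_first_set_index i dep).
apply/seteqP; split=> w /=.
  move=> q; rewrite (bigD1 (idx k w))//=; left; split=> //.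
  by rewrite (set_index_id (idx ^~ w) k).
elim/big_ind : _ => [//|B1 B2 H1 H2 [/H1//|/H2//]|i _ [/= <-]].
by rewrite (set_index_id (idx ^~ w) k).
Qed.

Lemma measurable_fun_first k (phi : (nat -> 'I_N) -> R) :
  depends_on_first k phi ->
  measurable_fun setT ((fun w => (phi (idx ^~ w))%:E) : T -> \bar R).
Proof.
move=> dep; apply/measurable_EFinP => _ B mB; rewrite setTI.
exact: measurable_first dep.
Qed.

Local Open Scope ereal_scope.

Let cylinder (K : {fset nat}) (a : nat -> 'I_N) : set T :=
  \bigcap_(k in [set` K]) (idx k @^-1` [set a k]).

Let cylinder_measurable K a : measurable (cylinder K a).
Proof. by apply: bigcap_measurableType => k _. Qed.

Let P_cylinder K a : P (cylinder K a) = \prod_(k <- K) (N%:R^-1)%:E.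
Proof.
have [_ P1 P2] := idxP; rewrite /cylinder (P2 K (fun k => [set a k])).
by apply: eq_bigr => k _; rewrite P1.
Qed.

Let cylinderU K a k i : k \notin K ->
  cylinder K a `&` idx k @^-1` [set i] = cylinder (k |` K)%fset (set_index a k i).
Proof.
move=> kK; apply/seteqP; split=> w /=.
  move=> [wK wi] n /=; rewrite in_fset1U => /predU1P[->|nK].
    by rewrite /set_index eqxx.
  rewrite /set_index; case: eqP => [nk|_]; last exact: wK.
  by rewrite -nk nK in kK.
move=> H; split=> [n /= nK|].
  have := H n; rewrite /= in_fset1U nK orbT /set_index => /(_ isT).
  by case: eqP => // nk; rewrite -nk nK in kK.
by have := H k; rewrite /= in_fset1U eqxx /set_index eqxx => /(_ isT).
Qed.

Lemma integral_split_index (E : set T) k (f : T -> \bar R) : measurable E ->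
  measurable_fun setT f -> (forall w, 0 <= f w) ->
  \int[P]_(w in E) f w = \sum_(i < N) \int[P]_(w in E `&` idx k @^-1` [set i]) f w.
Proof.
move=> mE mf f0.
have EE : E = \big[setU/set0]_(i <- index_enum 'I_N) (E `&` idx k @^-1` [set i]).
  apply/seteqP; split=> w /=.
    by move=> Ew; rewrite (bigD1 (idx k w))//=; left.
  by elim/big_ind : _ => [//|B1 B2 H1 H2 [/H1//|/H2//]|i _ []].
rewrite {1}EE ge0_integral_bigsetU//.
- by move=> i; exact: measurableI.
- exact: index_enum_uniq.
- by move=> i i' _ _ [w [[_ /= <-] [_ /= <-]]].
- exact: measurable_funTS.
Qed.

(** Independence of a function of the first [k] indices from the later ones.  The
   induction trades the last index on which the function depends for one more
   constraint in the cylinder, which is why arbitrary cylinders beyond [k] are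
   needed. *)
Lemma integral_cylinder k (phi : (nat -> 'I_N) -> R) K a :
  (forall b, 0 <= phi b)%R -> depends_on_first k phi ->
  (forall n, n \in K -> (k <= n)%N) ->
  \int[P]_(w in cylinder K a) (phi (idx ^~ w))%:E =
  P (cylinder K a) * \int[P]_w (phi (idx ^~ w))%:E.
Proof.
elim: k phi K a => [|k IH] phi K a phi0 dep Kk.
  have E w : phi (idx ^~ w) = phi (fun=> Ordinal N0) by exact: dep.
  under eq_integral do rewrite E.
  under [in RHS]eq_integral do rewrite E.
  by rewrite !integral_cst// [X in _ = _ * (_ * X)]probability_setT mule1 muleC.
pose psi i b := phi (set_index b k i).
have psi0 i b : (0 <= psi i b)%R by exact: phi0.
have psi_dep i : depends_on_first k (psi i) := depends_on_first_set_index i dep.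
have step K' b : (forall n, n \in K' -> (k < n)%N) ->
    \int[P]_(w in cylinder K' b) (phi (idx ^~ w))%:E =
    P (cylinder K' b) * \sum_(i < N) (N%:R^-1)%:E * \int[P]_w (psi i (idx ^~ w))%:E.
  move=> K'k; have kK' : k \notin K' by apply/negP => /K'k; rewrite ltnn.
  rewrite (integral_split_index k)//; first last.
  - by move=> w; rewrite lee_fin.
  - exact: measurable_fun_first dep.
  rewrite ge0_sume_distrr.
    apply: eq_bigr => i _.
    rewrite cylinderU// (eq_integral (fun w => (psi i (idx ^~ w))%:E)); last first.
      move=> w; rewrite inE -cylinderU// => -[_ /= wi].
      by rewrite /psi -wi (set_index_id (idx ^~ w) k).
    rewrite IH//.
      by rewrite !P_cylinder big_fsetU1//= -muleA muleCA.
    by move=> n; rewrite in_fset1U => /predU1P[->//|/K'k/ltnW].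
  move=> i _; rewrite mule_ge0 ?lee_fin ?invr_ge0// integral_ge0// => w _.
  by rewrite lee_fin.
rewrite step//; congr (_ * _); have := step fset0 a.
rewrite /cylinder set_fset0 bigcap_set0 probability_setT mul1e => -> //.
Qed.

(** Conditionally on the past, the index used at time [k] is uniform: the
   expectation of a sampled term is the average of the expectations. *)
Lemma integral_sampled k (psi : 'I_N -> (nat -> 'I_N) -> R) :
  (forall i b, 0 <= psi i b)%R -> (forall i, depends_on_first k (psi i)) ->
  \int[P]_w (psi (idx k w) (idx ^~ w))%:E =
  (N%:R^-1)%:E * \sum_(i < N) \int[P]_w (psi i (idx ^~ w))%:E.
Proof.
move=> psi0 dep.
have dep' : depends_on_first k.+1 (fun b => psi (b k) b).
  move=> a b ab; rewrite (ab k (ltnSn k)); apply: dep => n nk.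
  exact/ab/(ltn_trans nk).
rewrite (integral_split_index k measurableT)//; first last.
- by move=> w; rewrite lee_fin.
- exact: measurable_fun_first dep'.
rewrite ge0_sume_distrr; last first.
  by move=> i _; apply: integral_ge0 => w _; rewrite lee_fin.
apply: eq_bigr => i _.
have cylE : [set: T] `&` idx k @^-1` [set i] = cylinder [fset k]%fset (fun=> i).
  rewrite setTI; apply/seteqP; split=> w /=.
    by move=> wi n /=; rewrite in_fset1 => /eqP ->.
  by move=> /(_ k); apply; rewrite /= in_fset1.
rewrite (eq_integral (fun w => (psi i (idx ^~ w))%:E)); last first.
  by move=> w; rewrite inE => -[_ /= ->].
rewrite cylE (integral_cylinder _ (psi0 i) (dep i)).
  by rewrite P_cylinder big_seq_fset1.
by move=> n; rewrite in_fset1 => /eqP ->.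
Qed.

(** A pathwise bound on the sampled series controls the expectation of the series
   of averages, which therefore converges almost surely. *)
Lemma ae_bounded_averages (psi : nat -> 'I_N -> (nat -> 'I_N) -> R) (M : R) :
  (forall k i b, 0 <= psi k i b)%R ->
  (forall k i, depends_on_first k (psi k i)) ->
  (forall n b, \sum_(0 <= k < n) psi k (b k) b <= M)%R ->
  {ae P, forall w, exists M' : R, forall n,
    (\sum_(0 <= k < n) \sum_(i < N) psi k i (idx ^~ w) <= M')%R}.
Proof.
move=> psi0 dep bound.
pose f k w : \bar R := (\sum_(i < N) psi k i (idx ^~ w))%:E.
have f0 k w : 0 <= f k w by rewrite lee_fin sumr_ge0.
have depf k : depends_on_first k (fun b => \sum_(i < N) psi k i b)%R.
  by move=> a b ab; apply: eq_bigr => i _; exact: dep.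
have mf k : measurable_fun setT (f k) by exact: measurable_fun_first (depf k).
have Nn0 : (N%:R != 0 :> R)%R by rewrite pnatr_eq0 -lt0n.
have int_f k : \int[P]_w f k w = N%:R%:E * \int[P]_w (psi k (idx k w) (idx ^~ w))%:E.
  rewrite integral_sampled// muleA -EFinM divff// mul1e.
  rewrite -ge0_integral_sum//.
  - by apply: eq_integral => w _; rewrite /f sumEFin.
  - by move=> i; exact: measurable_fun_first (dep k i).
  - by move=> i w _; rewrite lee_fin.
have int_sum n : \sum_(0 <= k < n) \int[P]_w f k w <= (N%:R * M)%:E.
  under eq_bigr do rewrite int_f.
  rewrite -ge0_sume_distrr; last first.
    by move=> k _; apply: integral_ge0 => w _; rewrite lee_fin.
  have dep' k : depends_on_first k.+1 (fun b => psi k (b k) b).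
    move=> a b ab; rewrite (ab k (ltnSn k)); apply: dep => m mk.
    exact/ab/(ltn_trans mk).
  rewrite EFinM lee_pmul2l// ?lte_fin ?ltr0n//.
  rewrite -ge0_integral_sum//; first last.
  - by move=> k w _; rewrite lee_fin.
  - by move=> k; exact: measurable_fun_first (dep' k).
  have -> : M%:E = \int[P]_(w in setT) (cst M%:E w).
    by rewrite integral_cst// [X in _ = _ * X]probability_setT mule1.
  apply: ge0_le_integral => //.
  - by move=> w _; apply: sume_ge0 => k _; rewrite lee_fin.
  - by apply: emeasurable_sum => k; exact: measurable_fun_first (dep' k).
  - by move=> w _; rewrite sumEFin lee_fin bound.
have fin : \int[P]_w (\sum_(k <oo) f k w) < +oo.
  rewrite integral_nneseries//; apply: (@le_lt_trans _ _ (N%:R * M)%:E); last exact: ltry.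
  apply: lime_le; last by apply: nearW => n; exact: int_sum.
  by apply: is_cvg_nneseries => k _ _; exact: integral_ge0.
have mS : measurable_fun setT (fun w => \sum_(k <oo) f k w).
  exact: ge0_emeasurable_sum.
have S0 w : 0 <= \sum_(k <oo) f k w by apply: nneseries_ge0.
have int_S : P.-integrable setT (fun w => \sum_(k <oo) f k w).
  apply/integrableP; split=> //.
  by under eq_integral do rewrite gee0_abs//.
apply: filterS (integrable_ae measurableT int_S) => w /(_ I) Sfin.
exists (fine (\sum_(k <oo) f k w)) => n.
rewrite -lee_fin fineK// -sumEFin.
by apply: (@nneseries_lim_ge _ (f ^~ w) xpredT 0%N n) => k _ _; exact: f0.
Qed.

Lemma measurable_cvg0 (g : nat -> (nat -> 'I_N) -> R) :
  (forall k, depends_on_first k (g k)) ->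
  measurable [set w | g k (idx ^~ w) @[k --> \oo] --> (0 : R)%R].
Proof.
move=> dep.
rewrite (_ : [set w | _] = \bigcap_m \bigcup_n \bigcap_(k in [set k | (n <= k)%N])
    [set w | (`|g k (idx ^~ w)| < m.+1%:R^-1)%R]).
  apply: bigcapT_measurable => m; apply: bigcupT_measurable => n.
  apply: bigcap_measurableType => k _.
  exact: (measurable_first (fun z => (`|z| < m.+1%:R^-1)%R : Prop) (dep k)).
apply/seteqP; split=> w /=.
  move=> /cvgrPdist_lt H m _.
  have [|n _ Hn] := H m.+1%:R^-1%R; first by rewrite invr_gt0.
  exists n => // k /= nk; by have := Hn k nk; rewrite /= sub0r normrN.
move=> H; apply/cvgrPdist_lt => e e0.
have [m me] : exists m, (m.+1%:R^-1 < e)%R.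
  by have [m _ /(_ m (leqnn m))] := near_infty_natSinv_lt (PosNum e0); exists m.
have [n _ Hn] := H m I; exists n => // k nk.
by rewrite /= sub0r normrN; apply: lt_trans me; exact: Hn.
Qed.

Lemma probability1_ae (E : set T) :
  measurable E -> {ae P, forall w, E w} -> P E = 1.
Proof.
move=> mE aeE; have := measure_negligible (measurableC mE) aeE.
have := probability_setC P (measurableC mE); rewrite setCK => -> ->.
by rewrite sube0.
Qed.

End IndependentIndices.

(** * Almost sure convergence *)

Lemma sgd_depends_on_first (R : realType) (X : normedModType R) (N : nat)
    (Y : 'I_N -> normedModType R) (p ps : R) (F : forall i, X -> Y i)
    (dF : forall i, X -> blin X (Y i)) (j : forall i, Y i -> blin (Y i) R^o)
    (y : forall i, Y i) (mu : nat -> R) (x0 : X) (k : nat) :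
  depends_on_first k (fun b => sgd p ps F dF j y mu x0 b k).
Proof.
elim: k => [//|k IH] a b ab /=; rewrite (ab k (ltnSn k)).
by rewrite (IH a b)// => n nk; exact/ab/(ltn_trans nk).
Qed.

Lemma sum_unbounded (R : realType) (mu : nat -> R) : (forall k, 0 < mu k) ->
  (\sum_(0 <= k <oo) (mu k)%:E)%E = +oo%E ->
  forall A : R, exists n, A < \sum_(0 <= k < n) mu k.
Proof.
move=> mu0 mu_oo A; apply: contrapT => /forallNP H.
suff : (\sum_(0 <= k <oo) (mu k)%:E <= A%:E)%E by rewrite mu_oo leye_eq.
apply: lime_le; first by apply: is_cvg_nneseries => k _ _; rewrite lee_fin ltW.
by apply: nearW => n; rewrite sumEFin lee_fin leNgt; apply/negP; exact: H.
Qed.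

Theorem theorem3
  (R : realType)
  (* spaces and exponents *)
  (X : completeNormedModType R) (N : nat) (hN : (0 < N)%N)
  (Y : 'I_N -> completeNormedModType R) (r : R) (r1 : 1 <= r)
  (p ps : R) (p1 : 1 < p) (pps : p^-1 + ps^-1 = 1)
  (hXconvex : p_convex X p) (hXsmooth : uniformly_smooth X)
  (hYsmooth : uniformly_smooth (lrprod r1 Y))
  (* a selection of the duality map on each Y_i *)
  (j : forall i, Y i -> blin (Y i) R^o)
  (hj : forall i u, duality_set p u (j i u))
  (* the constant of p*-smoothness of the dual *)
  (G : R) (hG : 0 < G)
  (hGsmooth : forall zs ws : blin X R^o,
     bregman ps p zs ws <= G / ps * `|ws - zs| `^ ps)
  (* the operators, their domains, and the exact data *)
  (D : 'I_N -> set X) (F : forall i, X -> Y i) (y : forall i, Y i)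
  (* conditions on F *)
  (S : set X) (hSD : forall i, S `<=` D i)
  (hSclosed : closed S) (hSconvex : convex_set (S : set (convex_lmodType X)))
  (xd : X) (hxd : solutions D F y xd)
  (nu : R) (hnu : 0 < nu) (hball : bregman_ball p ps xd nu `<=` S)
  (dF : forall i, X -> blin X (Y i))
  (hdF : forall i x, S x -> is_frechet_derivative (D i) (F i) x (dF i x))
  (L : 'I_N -> R) (hL : forall i x, S x -> `|dF i x| <= L i)
  (Lmax : R) (hLmax : Lmax = \big[Num.max/0]_(i < N) L i)
  (gamma : R) (hgamma : 0 < gamma < 1)
  (hcone : forall i x x', S x -> S x' ->
     `|F i x - F i x' - dF i x (x - x')| <= gamma * `|F i x - F i x'|)
  (* initial point and step sizes *)
  (x0 : X) (hx0 : bregman_ball p ps xd nu x0)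
  (mu : nat -> R) (hmu : forall k, 0 < mu k)
  (C : R) (hC : 0 < C)
  (hstep : forall k,
     C <= 1 - gamma - Lmax `^ ps * (G / ps) * mu k `^ (ps - 1))
  (* random indices *)
  (d : measure_display) (T : measurableType d) (P : probability T R)
  (idx : nat -> T -> 'I_N) (hidx : iid_uniform P idx)
  (hmusum : (\sum_(0 <= k <oo) (mu k)%:E)%E = +oo%E) :
  let x (k : nat) (w : T) : X := sgd p ps F dF j y mu x0 (idx ^~ w) k in
  P [set w | inf [set `|x k w - z| | z in solutions D F y] @[k --> \oo] --> (0 : R)]
    = 1%E
  /\
  (weak_to_weak_continuous (\bigcap_i D i)
     ((fun z i => F i z) : X -> lrprod r1 Y) ->
   forall xmd : X,
   min_distance_solution p ps D F y S x0 xmd ->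
   (forall z, S z -> forall h : X,
      (forall i, dF i xmd h = 0) -> (forall i, dF i z h = 0)) ->
   P [set w | bregman p ps (x k w) xmd @[k --> \oo] --> (0 : R)] = 1%E).
Proof.
move=> x.
have Lmax_ge i z : S z -> `|dF i z| <= Lmax.
  move=> Sz; apply: (le_trans (hL i z Sz)).
  by rewrite hLmax (bigD1 i)//= le_max lexx.
have xdE i : F i xd = y i by case: (hxd i).
have sol_in z : solution_in F y S z -> solutions D F y z.
  by move=> [Sz Fz] i; split=> //; exact: hSD.
have mu_oo := sum_unbounded hmu hmusum.
have p0 : 0 < p := lt_trans ltr01 p1.
pose psi k i b := mu k * `|F i (sgd p ps F dF j y mu x0 b k) - y i| `^ p.
have psi0 k i b : 0 <= psi k i b by rewrite mulr_ge0 ?powR_ge0// ltW.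
have psi_dep k i : depends_on_first k (psi k i).
  by move=> a b ab; rewrite /psi (sgd_depends_on_first _ _ _ _ _ _ _ _ ab).
have psi_bound n b : \sum_(0 <= k < n) psi k (b k) b <= nu / C.
  exact: (sgd_sum_residuals p1 pps hXconvex hXsmooth hG hGsmooth hj Lmax_ge
    hcone hmu hC hstep hball hnu xdE hx0).
have path_cvg : {ae P, forall w, exists2 xh, solution_in F y S xh &
    bregman p ps (x n w) xh @[n --> \oo] --> (0 : R)}.
  apply: filterS (ae_bounded_averages hN hidx psi0 psi_dep psi_bound) => w [M HM].
  have summable n : \sum_(0 <= k < n)
      mu k * max_residual F y (x k w) `^ p <= M.
    apply: le_trans (HM n); apply: ler_sum => k _.
    by rewrite -mulr_sumr ler_pM2l// max_residual_pow_le.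
  exact: (sgd_path_cvg p1 pps hXconvex hXsmooth hG hGsmooth hj Lmax_ge
    hgamma hcone hmu hC hstep hball hnu xdE hx0 summable mu_oo hSclosed).
split.
- apply: probability1_ae.
    apply: (@measurable_cvg0 _ _ _ _ _ _ hN hidx (fun k b =>
      inf [set `|sgd p ps F dF j y mu x0 b k - z| | z in solutions D F y])).
    by move=> k a b ab; rewrite (sgd_depends_on_first _ _ _ _ _ _ _ _ ab).
  apply: filterS path_cvg => w [xh sol /(bregman_cvg0_norm p1 pps hXsmooth hG hGsmooth) H].
  apply: (squeeze_cvgr _ (cvg_cst 0) H); apply: nearW => k /=.
  apply/andP; split.
    apply: lb_le_inf; first by exists `|x k w - xh|, xh => //; exact: sol_in.
    by move=> _ [z _ <-].
  apply: ge_inf; first by exists 0 => _ [z _ <-].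
  by exists xh => //; exact: sol_in.
- move=> _ xmd [Sxmd xmd_sol xmd_inf] null_sub.
  have Fxmd i : F i xmd = y i by case: (xmd_sol i).
  apply: probability1_ae.
    apply: (@measurable_cvg0 _ _ _ _ _ _ hN hidx (fun k b =>
      bregman p ps (sgd p ps F dF j y mu x0 b k) xmd)).
    by move=> k a b ab; rewrite (sgd_depends_on_first _ _ _ _ _ _ _ _ ab).
  apply: filterS path_cvg => w [xh sol H].
  apply: (sgd_min_distance_cvg p1 pps hXconvex hXsmooth hG hGsmooth hj Lmax_ge
    hcone hmu hC hstep hball hnu xdE hx0 sol _ _ null_sub H) => //.
  rewrite xmd_inf; apply: ge_inf.
    exists 0 => _ [z _ <-]; exact: (bregman_ge0 p1 pps hXsmooth hG hGsmooth).
  by exists xh => //; split; [exact: sol_in|case: sol].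
Qed.
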